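(* Let $\alpha>0$, $p\ge 0$, $\beta>0$, $C\ge 1$, let $\tau_n>0$ satisfy $n\tau_n^2\to\infty$, let $\lambda_i=\tau_n^2 i^{-1-2\alpha}$ and $C^{-1}i^{-p}\le\kappa_i\le C i^{-p}$ for all $i\in\mathbb N$, and let $\mu_0\in S^\beta$. Define $$\varepsilon_n=(n\tau_n^2)^{-\left(\frac{\beta}{1+2\alpha+2p}\wedge 1\right)}+\tau_n\,(n\tau_n^2)^{-\frac{\alpha}{1+2\alpha+2p}} .$$ Then, for every sequence $M_n\to\infty$, $$\mathrm E_{\mu_0}\Pi_n\big(\mu:\ \|\mu-\mu_0\|_1\ge M_n\varepsilon_n\,\big|\,Y\big)\to 0\qquad(n\to\infty),$$ and the convergence is uniform over $\mu_0$ in balls $\{\mu_0\in S^\beta:\|\mu_0\|_\beta\le R\}$ for every $R>0$. In particular: (i) If $\tau_n\equiv 1$, then $\varepsilon_n\asymp n^{-(\alpha\wedge\beta)/(1+2\alpha+2p)}$. (ii) If $\beta\le 1+2\alpha+2p$ and $\tau_n\asymp n^{(\alpha-\beta)/(1+2\beta+2p)}$, then $\varepsilon_n\asymp n^{-\beta/(1+2\beta+2p)}$. (iii) If $\beta>1+2\alpha+2p$, then $\varepsilon_n\gg n^{-\beta/(1+2\beta+2p)}$ for every scaling $\tau_n$.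
   Context: Setting. $H_1,H_2$ are separable Hilbert spaces with norms $\|\cdot\|_1,\|\cdot\|_2$ and inner products $\langle\cdot,\cdot\rangle_1,\langle\cdot,\cdot\rangle_2$; $K:H_1\to H_2$ is a known injective continuous linear operator with adjoint $K^T$. For $\mu\in H_1$ one observes $Y=K\mu+n^{-1/2}Z$, $Z$ the iso-Gaussian process of $H_2$; this means that $Y=(Y_h:h\in H_2)$ is a Gaussian process with $\mathrm E Y_h=\langle K\mu,h\rangle_2$ and $\mathrm{cov}(Y_h,Y_{h'})=n^{-1}\langle h,h'\rangle_2$. $\mathrm E_{\mu_0}$ is expectation when $\mu=\mu_0$. For a continuous linear $B:H_2\to H_1$, $BY$ is the process $(BY)_h=Y_{B^Th}$, $h\in H_1$, identified with a random element of $H_1$ when such an element exists with $\langle BY,h\rangle_1=(BY)_h$. Prior and posterior. The prior on $\mu$ is the Gaussian distribution $N(0,\Lambda)$ on $H_1$. The operators $K^TK$ and $\Lambda$ have the same eigenfunctions $(e_i)_{i\in\mathbb N}$, an orthonormal basis of $H_1$, with eigenvalues $(\kappa_i^2)$ and $(\lambda_i)$, respectively ($\kappa_i>0$); the prior may depend on $n$ through $\tau_n$. The posterior $\Pi_n(\cdot\,|\,Y)$ is $N(AY,S_n)$ with $A=\Lambda K^T(n^{-1}I+K\Lambda K^T)^{-1}$ and $S_n=\Lambda-A(n^{-1}I+K\Lambda K^T)A^T$. In coordinates $\mu=\sum_i\mu_ie_i$, with $Ke_i=\kappa_if_i$ and $Y_i=Y_{f_i}$, under the posterior the $\mu_i$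 are independent $N\big(n\lambda_i\kappa_iY_i/(1+n\lambda_i\kappa_i^2),\ \lambda_i/(1+n\lambda_i\kappa_i^2)\big)$. Sobolev space. For $\mu=\sum_i\mu_ie_i$, $\|\mu\|_\beta^2=\sum_i\mu_i^2i^{2\beta}$ and $S^\beta=\{\mu\in H_1:\|\mu\|_\beta<\infty\}$. Notation. $a\wedge b=\min(a,b)$; $a_n\asymp b_n$ means $|a_n/b_n|$ is bounded away from $0$ and $\infty$ as $n\to\infty$; $a_n\gg b_n$ means $b_n/a_n\to0$. *)

(* Defs.v *)
From HB Require Import structures.
From mathcomp Require Import all_boot all_order all_algebra.
From mathcomp Require Import all_classical all_reals all_analysis.

Set Implicit Arguments.
Unset Strict Implicit.
Unset Printing Implicit Defensive.

Import Order.TTheory GRing.Theory Num.Theory.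
Import numFieldNormedType.Exports.

Local Open Scope classical_set_scope.
Local Open Scope ring_scope.

(* A real Hilbert space is a [completeNormedModType R] together with an inner
   product [ip : {dot H for idfun}] that induces its norm. *)
Definition induces_norm (R : realType) (H : completeNormedModType R)
    (ip : {dot H for idfun}) : Prop :=
  forall x : H, ip x x = `|x| ^+ 2.

Definition separable (T : topologicalType) : Prop :=
  exists D : set T, countable D /\ dense D.

Definition orthonormal_basis (R : realType) (H : completeNormedModType R)
    (ip : {dot H for idfun}) (e : nat -> H) : Prop :=
  (forall i j : nat, ip (e i) (e j) = (i == j)%:R) /\
  (forall x : H, series (fun i => ip x (e i) *: e i) @ \oo --> x).

(* The element x with <T z, y>_2 = <z, x>_1 for all z; it exists and is unique
   when T is linear and continuous (Riesz). *)
Definition adjoint (R : realType) (H1 H2 : completeNormedModType R)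
    (ip1 : {dot H1 for idfun}) (ip2 : {dot H2 for idfun})
    (T : H1 -> H2) (y : H2) : H1 :=
  xget 0 [set x : H1 | forall z : H1, ip2 (T z) y = ip1 z x].

Section posterior_operators.
Context (R : realType) (H1 H2 : completeNormedModType R).
Context (ip1 : {dot H1 for idfun}) (ip2 : {dot H2 for idfun}).
Context (K : H1 -> H2) (Lam : H1 -> H1) (n : nat).

(* n^-1 I + K Lam K^T *)
Definition data_covariance (y : H2) : H2 :=
  n%:R^-1 *: y + K (Lam (adjoint ip1 ip2 K y)).

(* A = Lam K^T (n^-1 I + K Lam K^T)^-1, where [pinv setT] is the inverse of the
   bijection [data_covariance]. *)
Definition posterior_gain (y : H2) : H1 :=
  Lam (adjoint ip1 ip2 K (pinv setT data_covariance y)).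

(* S = Lam - A (n^-1 I + K Lam K^T) A^T *)
Definition posterior_covariance (x : H1) : H1 :=
  Lam x - posterior_gain (data_covariance (adjoint ip2 ip1 posterior_gain x)).

End posterior_operators.

(* [normal_prob m 0] is not a point mass in the library, whence the separate
   treatment of the degenerate law N(m, 0); v is the variance. *)
Definition normally_distributed (d : measure_display) (T : measurableType d)
    (R : realType) (P : {measure set T -> \bar R}) (X : T -> R) (m v : R) :
    Prop :=
  0 <= v /\
  forall A : set R, measurable A ->
    P (X @^-1` A) =
      if v == 0 then dirac m A else normal_prob m (Num.sqrt v) A.

Notation borel H := (g_sigma_algebraType (@open H)).

(* The law N(m, S) on H: every <x, h> is N(<m, h>, <S h, h>). *)
Definition gaussian_measure (R : realType) (H : completeNormedModType R)
    (ip : {dot H for idfun}) (nu : {measure set (borel H) -> \bar R})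
    (m : H) (S : H -> H) : Prop :=
  forall h : H,
    normally_distributed nu (fun x : borel H => ip (x : H) h)
      (ip m h) (ip (S h) h).

Definition gaussian_process (d : measure_display) (Omega : measurableType d)
    (R : realType) (I : Type) (P : probability Omega R)
    (Y : I -> {mfun Omega >-> R}) : Prop :=
  forall (k : nat) (c : 'I_k -> R) (h : 'I_k -> I),
    exists m v : R,
      normally_distributed P (fun w => \sum_(i < k) c i * Y (h i) w) m v.

(* Under P, Y = theta + n^{-1/2} Z with Z the iso-Gaussian process of H. *)
Definition white_noise_model (d : measure_display) (Omega : measurableType d)
    (R : realType) (H : completeNormedModType R) (ip : {dot H for idfun})
    (P : probability Omega R) (Y : H -> {mfun Omega >-> R})
    (theta : H) (n : nat) : Prop :=
  [/\ gaussian_process P Y,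
      forall h : H, expectation P (Y h) = (ip theta h)%:E
    & forall h h' : H, covariance P (Y h) (Y h') = (n%:R^-1 * ip h h')%:E].

(* X is a random element of H1 representing the process
   BY = (Y_{B^T h} : h in H1). *)
Definition represents_image (d : measure_display) (Omega : measurableType d)
    (R : realType) (H1 H2 : completeNormedModType R)
    (ip1 : {dot H1 for idfun}) (ip2 : {dot H2 for idfun})
    (P : probability Omega R) (Y : H2 -> {mfun Omega >-> R})
    (B : H2 -> H1) (X : Omega -> H1) : Prop :=
  forall h : H1,
    {ae P, forall w, ip1 (X w) h = Y (adjoint ip2 ip1 B h) w}.

Definition process_events (d : measure_display) (Omega : measurableType d)
    (R : realType) (I : Type) (Y : I -> {mfun Omega >-> R}) :
    set (set Omega) :=
  <<s [set B | exists (h : I) (A : set R),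
        measurable A /\ B = Y h @^-1` A] >>.

(* [post] is a regular conditional distribution of mu given Y when mu ~ prior
   and the law of the observation given mu is [P mu]. *)
Definition posterior_distribution (d : measure_display)
    (Omega : measurableType d) (R : realType)
    (H1 : completeNormedModType R) (I : Type)
    (prior : probability (borel H1) R) (P : H1 -> probability Omega R)
    (Y : I -> {mfun Omega >-> R}) (post : R.-pker Omega ~> borel H1) : Prop :=
  forall (U : set (borel H1)) (B : set Omega),
    measurable U -> process_events Y B ->
    (\int[prior]_(mu in U) P mu B =
     \int[prior]_mu \int[P mu]_(w in B) post w U)%E.

(* Coordinates are numbered from 0, so i^{2 beta} is written with i.+1. *)
Definition sobolev_norm (R : realType) (H : completeNormedModType R)
    (ip : {dot H for idfun}) (e : nat -> H) (beta : R) (mu : H) : \bar R :=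
  ((\sum_(0 <= i <oo)
      ((ip mu (e i)) ^+ 2 * i.+1%:R `^ (2 * beta))%:E) `^ 2^-1)%E.

Definition sobolev_space (R : realType) (H : completeNormedModType R)
    (ip : {dot H for idfun}) (e : nat -> H) (beta : R) : set H :=
  [set mu | (sobolev_norm ip e beta mu < +oo)%E].

Definition rate (R : realType) (alpha beta p : R) (tau : nat -> R) (n : nat) : R :=
  (n%:R * tau n ^+ 2) `^ (- Num.min (beta / (1 + 2 * alpha + 2 * p)) 1) +
  tau n * (n%:R * tau n ^+ 2) `^ (- (alpha / (1 + 2 * alpha + 2 * p))).

(* E Pi(mu : ||mu - mu0|| >= r | Y), with E the expectation under P *)
Definition expected_posterior_mass (d : measure_display)
    (Omega : measurableType d) (R : realType) (H : completeNormedModType R)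
    (P : probability Omega R) (post : R.-pker Omega ~> borel H)
    (mu0 : H) (r : R) : \bar R :=
  (\int[P]_w post w [set mu : H | (r <= `|mu - mu0|)%R])%E.

Definition same_order (R : realType) (a b : nat -> R) : Prop :=
  exists c C : R, [/\ 0 < c, 0 < C
    & \forall n \near \oo, c <= `|a n / b n| <= C].

Definition much_larger (R : realType) (a b : nat -> R) : Prop :=
  b n / a n @[n --> \oo] --> (0 : R).

(* Main.v *)
Require Import Defs.
From HB Require Import structures.
From mathcomp Require Import all_boot all_order all_algebra.
From mathcomp Require Import all_classical all_reals all_analysis.
From mathcomp Require Import measurable_realfun ring lra.

Set Implicit Arguments.
Unset Strict Implicit.
Unset Printing Implicit Defensive.

Import Order.TTheory GRing.Theory Num.Theory.
Import numFieldNormedType.Exports.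

Local Open Scope classical_set_scope.
Local Open Scope ring_scope.

(** The posterior mass outside a ball is bounded by a second moment. Since
    both K^T K and the prior covariance are diagonal in the basis e, Parseval
    splits E int |mu - mu0|^2 dPi(mu | Y) into a sum over coordinates, and in
    coordinate i everything is one-dimensional. Write lam_i for the prior
    variance, k_i = kappa_i^2 and u_i = n lam_i k_i. The posterior is Gaussian
    with variance s_i = lam_i / (1 + u_i), and its mean is a linear functional
    of the white noise with bias mu0_i / (1 + u_i) and variance at most s_i.
    Hence, up to numerical factors, the risk is at most

      sum_i lam_i / (1 + u_i)  +  sum_i mu0_i^2 / (1 + u_i)^2.

    With D = 1 + 2 alpha + 2 p, x = n tau^2 and j = i + 1, the assumptions on
    kappa give u_i >= c x j^(-D). In the second sum, 1 + t >= t^theta with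
    theta = min(beta / D, 1) turns each term into
    (c x)^(-2 theta) mu0_i^2 j^(2 beta), so the bias is controlled by the
    Sobolev norm. In the first sum the choice N = (c x)^(1/D) makes the
    denominator 1 + (N / j)^D, which is comparable to a power of (N + j) / j;
    the terms become tau^2 (N + j)^(-1 - 2 alpha) and telescope against
    (N + j)^(-2 alpha), giving tau^2 x^(-2 alpha / D). So the risk is at most a
    constant times rate^2, with a constant that depends on mu0 only through
    its Sobolev norm, and the bound const / M_n^2 from Markov's inequality
    gives both the pointwise and the uniform statement.

    The carrying lemmas are [gaussian_mass_le] (Markov and Parseval for a
    Gaussian measure), [posterior_gain_coef], [adjoint_gain] and
    [posterior_variance_coef] (the posterior in coordinates),
    [expected_posterior_mass_le] and [risk_series_le]. The three statements on
    the rate are computations with powers of n. When beta > D, the two summands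
    of the rate move in opposite directions as functions of x, and at their
    crossing point they equal n^(-D / (1 + 2 D + 2 p)), which is of larger
    order than n^(-beta / (1 + 2 beta + 2 p)). *)

(** * Inequalities for real powers *)

Lemma powR_le1D (R : realType) (t theta : R) :
  0 <= t -> 0 <= theta <= 1 -> t `^ theta <= 1 + t.
Proof.
move=> t0 /andP[th0 th1].
have [t1|/ltW t1] := leP t 1.
  apply: (@le_trans _ _ (1 `^ theta)).
    by apply: ge0_ler_powR; rewrite ?nnegrE.
  by rewrite powR1 lerDl.
by apply: (le_trans (ler1_powR t1 th1)); rewrite lerDr.
Qed.

Lemma powR_sqr (R : realType) (x a : R) : x `^ a ^+ 2 = x `^ (2 * a).
Proof. by rewrite mulrC powRrM powR_mulrn ?powR_ge0. Qed.

Lemma ler_powRN (R : realType) (x y a : R) :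
  0 <= a -> 0 < x -> x <= y -> y `^ (- a) <= x `^ (- a).
Proof.
move=> a0 x0 xy; have y0 := lt_le_trans x0 xy.
rewrite !powRN lef_pV2 ?posrE ?powR_gt0//.
by apply: ge0_ler_powR; rewrite ?nnegrE ?(ltW x0) ?(ltW y0).
Qed.

(** Bias of one coordinate: [u] is the signal-to-noise ratio n lam_i k_i and
    [(1 + u)^-1] the factor by which the posterior mean misses the truth.
    [powR_le1D] trades this factor for a power of [x] at the price of the
    Sobolev weight, which is affordable as long as [D * theta <= beta]; the
    restriction [theta <= 1] is the saturation of the rate. *)
Lemma shrinkage_bias_le (R : realType) (c x j u D theta beta : R) :
  0 < c -> 0 < x -> 1 <= j -> 0 <= theta <= 1 -> D * theta <= beta ->
  c * x * j `^ (- D) <= u ->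
  (1 + u)^-1 ^+ 2 <= ((c * x) `^ (- theta)) ^+ 2 * j `^ (2 * beta).
Proof.
move=> c0 x0 j1 /andP[th0 th1] Db hu.
have j0 : 0 < j by exact: lt_le_trans j1.
set t := _ * _ * _ in hu.
have t0 : 0 < t by rewrite /t !mulr_gt0 ?powR_gt0.
have u0 : 0 < u by exact: lt_le_trans hu.
have -> : j `^ (2 * beta) = j `^ beta ^+ 2 by rewrite powR_sqr.
rewrite -exprMn; apply: lerXn2r; rewrite ?nnegrE ?invr_ge0 ?mulr_ge0 ?powR_ge0//.
  by rewrite addr_ge0// ltW.
apply: (@le_trans _ _ (t `^ (- theta))).
  rewrite powRN lef_pV2 ?posrE ?powR_gt0 ?addr_gt0//.
  apply: (le_trans (powR_le1D (ltW t0) _)); first by rewrite th0.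
  by rewrite lerD2l.
rewrite /t (powRM _ (ltW (mulr_gt0 c0 x0)) (powR_ge0 _ _)).
rewrite -powRrM mulrNN ler_wpM2l ?powR_ge0//.
exact: ler_powR.
Qed.

(** The convex function [fun t => t `^ (- s)] lies above its tangent at
    [a + 1]. Summed over [a = N + i] this bounds a tail of the zeta-like series
    by a telescoping sum. *)
Lemma powR_tangent (R : realType) (a s : R) : 0 < a -> 0 < s ->
  s * (a + 1) `^ (- 1 - s) <= a `^ (- s) - (a + 1) `^ (- s).
Proof.
move=> a0 s0; have b0 : 0 < a + 1 by rewrite addr_gt0.
set b := a + 1 in b0 *.
have nb : b != 0 by rewrite gt_eqF.
have -> : a = b * (1 - b^-1) by rewrite mulrBr mulr1 divff// /b addrK.
have y0 : 0 < 1 - b^-1.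
  by rewrite subr_gt0 invf_lt1// /b ltrDr.
rewrite powRM ?(ltW b0) ?(ltW y0)// powRD ?nb ?implybT// powR_inv1 ?(ltW b0)//.
have H : 1 + s / b <= (1 - b^-1) `^ (- s).
  rewrite /powR gt_eqF//; apply: le_trans (expR_ge1Dx _).
  rewrite lerD2l mulNr -mulrN ler_pM2l// lerNr.
  by apply: le_ln1Dx; rewrite ltrN2 invf_lt1// /b ltrDr.
rewrite mulrA mulrC -[X in _ <= _ - X]mulr1 -mulrBr ler_wpM2l ?powR_ge0//.
by rewrite lerBrDl.
Qed.

(** Smooths the transition between the coordinates with [j <= N], where the
    data dominate, and those with [j > N], where the prior dominates, so that
    the sum over [j] need not be split at [N]. *)
Lemma spread_term_le (R : realType) (N j q D : R) :
  0 < N -> 0 < j -> 0 <= q -> q <= D ->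
  j `^ (- q) / (1 + (N / j) `^ D) <= 2 `^ q * (N + j) `^ (- q).
Proof.
move=> N0 j0 q0 qD.
have nj : j != 0 by rewrite gt_eqF.
have -> : N + j = j * (1 + N / j) by rewrite mulrDr mulr1 mulrCA divff// mulr1 addrC.
have v0 : 0 < N / j by rewrite divr_gt0.
set v := N / j in v0 *; clearbody v.
have v1 : 0 < 1 + v by rewrite addr_gt0.
rewrite powRM ?(ltW j0) ?(ltW v1)// mulrCA ler_wpM2l ?powR_ge0//.
rewrite powRN -ler_pdivrMr ?invr_gt0 ?powR_gt0// invrK mulrC.
have w0 : 0 < 1 + v `^ D by rewrite ltr_wpDr ?powR_ge0.
rewrite ler_pdivrMr//.
have [v_le1|/ltW v_ge1] := leP v 1.
  apply: (@le_trans _ _ (2 `^ q)); last by rewrite ler_peMr ?powR_ge0// lerDl powR_ge0.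
  apply: ge0_ler_powR; rewrite ?nnegrE ?(ltW v1)//; lra.
apply: (@le_trans _ _ ((2 * v) `^ q)).
  apply: ge0_ler_powR; rewrite ?nnegrE ?(ltW v1) ?mulr_ge0 ?(ltW v0)//; lra.
rewrite powRM ?(ltW v0)// ler_wpM2l ?powR_ge0//.
apply: (le_trans (ler_powR v_ge1 qD)).
by rewrite lerDr.
Qed.

(** The trace of the posterior covariance, up to the factor tau^2; [y] is
    proportional to n tau^2, and [y `^ D^-1] is the order of the number of
    coordinates in which the data dominate the prior. *)
Lemma posterior_spread_sum_le (R : realType) (y alpha D : R) (m : nat) :
  0 < y -> 0 < alpha -> 1 + 2 * alpha <= D ->
  \sum_(i < m) i.+1%:R `^ (- 1 - 2 * alpha) / (1 + y * i.+1%:R `^ (- D)) <=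
  2 `^ (1 + 2 * alpha) / (2 * alpha) * y `^ (- (2 * alpha / D)).
Proof.
move=> y0 al0 qD; have D0 : 0 < D by apply: lt_le_trans qD; lra.
have s0 : 0 < 2 * alpha by rewrite mulr_gt0.
set q := 1 + 2 * alpha in qD *.
have q0 : 0 <= q by rewrite /q; lra.
(* Chosen so that y * j `^ (- D) = (N / j) `^ D. *)
set N := y `^ D^-1.
have N0 : 0 < N by rewrite powR_gt0.
have NE : N `^ D = y by rewrite -powRrM mulVf ?gt_eqF// powRr1 ?ltW.
pose g (i : nat) : R := (N + i%:R) `^ (- (2 * alpha)).
have -> : y `^ (- (2 * alpha / D)) = g 0%N.
  rewrite /g addr0 -powRrM; congr (_ `^ _); by rewrite mulrN mulrC.
apply: (@le_trans _ _ (2 `^ q / (2 * alpha) * \sum_(i < m) (g i - g i.+1))).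
  rewrite mulr_sumr; apply: ler_sum => i _.
  have i0 : 0 < i.+1%:R :> R by rewrite ltr0n.
  have -> : - 1 - 2 * alpha = - q by rewrite /q; lra.
  have -> : y * i.+1%:R `^ (- D) = (N / i.+1%:R) `^ D.
    rewrite powRM ?(ltW N0) ?invr_ge0 ?(ltW i0)// NE; congr (_ * _).
    by rewrite -[i.+1%:R^-1]powR_inv1 ?(ltW i0)// -powRrM mulN1r.
  apply: (le_trans (spread_term_le N0 i0 q0 qD)).
  rewrite -mulrA ler_wpM2l ?powR_ge0//.
  rewrite mulrC ler_pdivlMr// mulrC.
  have Ni : 0 < N + i%:R by rewrite ltr_wpDr ?ler0n.
  have := powR_tangent Ni s0.
  rewrite /g -[i.+1%:R]natr1 addrA; congr (_ * (_ `^ _) <= _); rewrite /q; lra.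
rewrite ler_wpM2l ?divr_ge0 ?powR_ge0 ?(ltW s0)//.
rewrite -(big_mkord xpredT (fun i => g i - g i.+1)).
rewrite (telescope_sumr_eq (fun i => - g i))//; last by move=> i _; rewrite opprK addrC.
by rewrite opprK addrC lerBlDr lerDl powR_ge0.
Qed.

(** * The size of the rate for particular scalings *)

Lemma powRn_cvg0 (R : realType) (eta : R) : 0 < eta ->
  n%:R `^ (- eta) @[n --> \oo] --> (0 : R).
Proof.
move=> eta0; apply/cvgr0Pnorm_le => eps eps0.
have N0 : 0 < eps `^ (- eta^-1) by rewrite powR_gt0.
near=> n.
rewrite ger0_norm ?powR_ge0//.
have -> : eps = (eps `^ (- eta^-1)) `^ (- eta).
  by rewrite -powRrM mulrNN mulVf ?gt_eqF// powRr1 ?(ltW eps0).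
apply: ler_powRN => //; first exact: ltW.
by near: n; exact: nbhs_infty_ger.
Unshelve. all: by end_near. Qed.

(** Both exponents are available and the smaller one decides; the cap 1 in the
    bias exponent never wins because alpha / D < 1. *)
Lemma rate_unscaled (R : realType) (alpha beta p : R) (tau : nat -> R) :
  0 < alpha -> 0 <= p -> 0 < beta -> (forall n, (0 < n)%N -> tau n = 1) ->
  same_order (rate alpha beta p tau)
    (fun n => n%:R `^ (- (Num.min alpha beta / (1 + 2 * alpha + 2 * p)))).
Proof.
move=> halpha hp hbeta; set D := 1 + 2 * alpha + 2 * p.
have D_gt0 : 0 < D by rewrite /D; lra.
move=> tau1; exists 1, 2; split => //.
near=> n.
have n0 : (0 < n)%N by near: n; exact: nbhs_infty_gt.
have n1 : 1 <= n%:R :> R by rewrite ler1n.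
rewrite /rate tau1// expr1n mulr1 mul1r -/D.
set b := Num.min (beta / D) 1; set m := Num.min alpha beta / D.
have a1 : alpha / D <= 1 by rewrite ler_pdivrMr// mul1r /D; lra.
(* Both exponents of the rate are at least m, and m is one of them. *)
have [mb ma mE] : [/\ m <= b, m <= alpha / D & m = b \/ m = alpha / D].
  rewrite /m /b; have [ab|/ltW ba] := leP alpha beta.
  - split; [|by []|by right].
    by rewrite le_min a1 ler_pM2r ?invr_gt0// ab.
  - have bD : beta / D <= alpha / D by rewrite ler_pM2r ?invr_gt0.
    rewrite (min_l (le_trans bD a1)); split => //; by left.
have m0 : 0 < n%:R `^ (- m) :> R by rewrite powR_gt0// ltr0n.
rewrite ger0_norm ?divr_ge0 ?addr_ge0 ?powR_ge0//.
rewrite ler_pdivlMr// ler_pdivrMr// mul1r.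
have hb : n%:R `^ (- b) <= n%:R `^ (- m) :> R by apply: ler_powR => //; rewrite lerN2.
have ha : n%:R `^ (- (alpha / D)) <= n%:R `^ (- m) :> R
  by apply: ler_powR => //; rewrite lerN2.
apply/andP; split; last by rewrite mulr_natl mulr2n lerD.
by case: mE => ->; rewrite ?lerDl ?lerDr powR_ge0.
Unshelve. all: by end_near. Qed.

(** With this scaling n tau^2 is of order n^(D / E), where
    E = 1 + 2 beta + 2 p, and the two summands of the rate both have order
    n^(- beta / E). *)
Lemma rate_optimal_scaling (R : realType) (alpha beta p : R) (tau : nat -> R) :
  0 < alpha -> 0 <= p -> 0 < beta ->
  (forall n, (0 < n)%N -> 0 < tau n) -> beta <= 1 + 2 * alpha + 2 * p ->
  same_order tau (fun n => n%:R `^ ((alpha - beta) / (1 + 2 * beta + 2 * p))) ->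
  same_order (rate alpha beta p tau)
    (fun n => n%:R `^ (- (beta / (1 + 2 * beta + 2 * p)))).
Proof.
move=> halpha hp hbeta; set D := 1 + 2 * alpha + 2 * p.
have D_gt0 : 0 < D by rewrite /D; lra.
move=> tau0 bD [c [C [c0 C0 tauE]]].
set E := 1 + 2 * beta + 2 * p in tauE *.
have E0 : 0 < E by rewrite /E; lra.
pose u := beta / D; pose v := alpha / D.
have u0 : 0 <= u by rewrite divr_ge0 ?ltW.
have v0 : 0 <= v by rewrite divr_ge0 ?ltW.
exists ((C ^+ 2) `^ (- u) + c * (C ^+ 2) `^ (- v)).
exists ((c ^+ 2) `^ (- u) + C * (c ^+ 2) `^ (- v)).
have c20 : 0 < c ^+ 2 by rewrite exprn_gt0.
have C20 : 0 < C ^+ 2 by rewrite exprn_gt0.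
split; [by rewrite addr_gt0 ?mulr_gt0 ?powR_gt0| by rewrite addr_gt0 ?mulr_gt0 ?powR_gt0|].
near=> n.
have n0 : (0 < n)%N by near: n; exact: nbhs_infty_gt.
have nR0 : 0 < n%:R :> R by rewrite ltr0n.
have : c <= `|tau n / n%:R `^ ((alpha - beta) / E)| <= C by near: n.
set t := n%:R `^ ((alpha - beta) / E).
have t0 : 0 < t by rewrite powR_gt0.
have taun := tau0 n n0.
rewrite gtr0_norm ?divr_gt0// ler_pdivlMr// ler_pdivrMr// => /andP[ct tC].
have nt0 : 0 < n%:R * t ^+ 2 by rewrite mulr_gt0 ?exprn_gt0.
have ntE : n%:R * t ^+ 2 = n%:R `^ (D / E).
  rewrite /t powR_sqr -{1}[n%:R]powRr1// -powRD; last by rewrite (gt_eqF nR0) implybT.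
  have nE : E != 0 by rewrite gt_eqF.
  congr (_ `^ _); apply: (mulIf nE).
  by rewrite mulrDl mul1r -mulrA !divfK// /D /E; ring.
have ntu : (n%:R * t ^+ 2) `^ (- u) = n%:R `^ (- (beta / E)).
  rewrite ntE -powRrM; congr (_ `^ _).
  by rewrite /u; field; rewrite !gt_eqF.
have ntv : t * (n%:R * t ^+ 2) `^ (- v) = n%:R `^ (- (beta / E)).
  rewrite ntE -powRrM /t -powRD; last by rewrite (gt_eqF nR0) implybT.
  congr (_ `^ _); rewrite /v mulrN.
  have -> : D / E * (alpha / D) = alpha / E.
    by field; rewrite !gt_eqF.
  by rewrite -mulrBl addrAC subrr add0r mulNr.
have lo : c ^+ 2 * (n%:R * t ^+ 2) <= n%:R * tau n ^+ 2.
  rewrite [X in X <= _]mulrCA -exprMn ler_pM2l//.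
  by apply: lerXn2r => //; rewrite nnegrE ltW// mulr_gt0.
have hi : n%:R * tau n ^+ 2 <= C ^+ 2 * (n%:R * t ^+ 2).
  rewrite [X in _ <= X]mulrCA -exprMn ler_pM2l//.
  by apply: lerXn2r => //; rewrite nnegrE ltW// mulr_gt0.
have x0 : 0 < n%:R * tau n ^+ 2 by rewrite mulr_gt0 ?exprn_gt0.
rewrite /rate -/D -/v (min_l _); last by rewrite ler_pdivrMr// mul1r.
rewrite -/u ger0_norm; last first.
  by rewrite divr_ge0 ?powR_ge0// addr_ge0 ?mulr_ge0 ?powR_ge0// ltW.
have r0 : 0 < n%:R `^ (- (beta / E)) :> R by rewrite powR_gt0.
rewrite ler_pdivlMr// ler_pdivrMr// !mulrDl.
have := ler_powRN u0 x0 hi; rewrite (powRM _ (ltW C20) (ltW nt0)) ntu => hi_u.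
have := ler_powRN v0 x0 hi; rewrite (powRM _ (ltW C20) (ltW nt0)) => hi_v.
have := ler_powRN u0 (mulr_gt0 c20 nt0) lo; rewrite (powRM _ (ltW c20) (ltW nt0)) ntu => lo_u.
have := ler_powRN v0 (mulr_gt0 c20 nt0) lo; rewrite (powRM _ (ltW c20) (ltW nt0)) => lo_v.
apply/andP; split; apply: lerD => //; rewrite -ntv.
- rewrite mulrACA; apply: ler_pM => //; rewrite ?mulr_ge0 ?powR_ge0// ltW//.
- rewrite mulrACA; apply: ler_pM => //; rewrite ?powR_ge0// ltW//.
Unshelve. all: by end_near. Qed.

(** For fixed n the first summand of the rate decreases in n tau^2 and the
    second one increases, so their maximum is smallest where they agree. *)
Lemma rate_ge (R : realType) (alpha beta p : R) (tau : nat -> R) n :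
  0 < alpha -> 0 <= p -> 0 < beta -> (0 < n)%N -> 0 < tau n ->
  1 + 2 * alpha + 2 * p < beta ->
  n%:R `^ (- ((1 + 2 * alpha + 2 * p) /
    (1 + 2 * (1 + 2 * alpha + 2 * p) + 2 * p))) <= rate alpha beta p tau n.
Proof.
move=> halpha hp hbeta; set D := 1 + 2 * alpha + 2 * p.
have D_gt0 : 0 < D by rewrite /D; lra.
move=> n0 t0 Db; set G := 1 + 2 * D + 2 * p.
have G0 : 0 < G by rewrite /G; lra.
have nR0 : 0 < n%:R :> R by rewrite ltr0n.
rewrite /rate -/D (min_r _); last by rewrite ler_pdivlMr// mul1r ltW.
set x := n%:R * tau n ^+ 2.
have x0 : 0 < x by rewrite mulr_gt0 ?exprn_gt0.
(* At x = n `^ (D / G) the two summands of the rate coincide. *)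
have [xs|/ltW xl] := leP x (n%:R `^ (D / G)).
  apply: (@le_trans _ _ (x `^ (- 1))); last by rewrite lerDl mulr_ge0 ?powR_ge0 ?ltW.
  apply: le_trans (ler_powRN ler01 x0 xs).
  by rewrite -powRrM mulrN mulr1.
apply: (@le_trans _ _ (tau n * x `^ (- (alpha / D)))); last by rewrite lerDr powR_ge0.
have -> : tau n = n%:R `^ (- 2^-1) * x `^ 2^-1.
  rewrite /x (powRM _ (ltW nR0) (sqr_ge0 _)) mulrA -powRD; last by rewrite (gt_eqF nR0) implybT.
  by rewrite addNr powRr0 mul1r -powR_mulrn ?(ltW t0)// -powRrM divff// powRr1 ?(ltW t0).
rewrite -mulrA -powRD; last by rewrite (gt_eqF x0) implybT.
have d0 : 0 <= 2^-1 - alpha / D.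
  rewrite subr_ge0 ler_pdivrMr// /D; lra.
have xd : (n%:R `^ (D / G)) `^ (2^-1 - alpha / D) <= x `^ (2^-1 - alpha / D).
  by apply: ge0_ler_powR; rewrite ?nnegrE ?powR_ge0 ?(ltW x0).
apply: le_trans (ler_wpM2l (powR_ge0 _ _) xd).
rewrite -powRrM -powRD; last by rewrite (gt_eqF nR0) implybT.
suff -> : - (D / G) = - 2^-1 + D / G * (2^-1 - alpha / D) by [].
have nG : G != 0 by rewrite gt_eqF.
have nD : D != 0 by rewrite gt_eqF.
apply: (mulIf nG).
have -> : D / G * (2^-1 - alpha / D) = (D / 2 - alpha) / G by field; rewrite nD nG.
by rewrite [RHS]mulrDl !mulNr !divfK// /G /D; field.
Qed.

Lemma rate_suboptimal (R : realType) (alpha beta p : R) (tau : nat -> R) :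
  0 < alpha -> 0 <= p -> 0 < beta ->
  (forall n, (0 < n)%N -> 0 < tau n) -> 1 + 2 * alpha + 2 * p < beta ->
  much_larger (rate alpha beta p tau)
    (fun n => n%:R `^ (- (beta / (1 + 2 * beta + 2 * p)))).
Proof.
move=> halpha hp hbeta; set D := 1 + 2 * alpha + 2 * p.
have D_gt0 : 0 < D by rewrite /D; lra.
move=> tau0 Db.
set E := 1 + 2 * beta + 2 * p; set G := 1 + 2 * D + 2 * p.
have E0 : 0 < E by rewrite /E; lra.
have G0 : 0 < G by rewrite /G; lra.
have eta0 : 0 < beta / E - D / G.
  rewrite subr_gt0 ltr_pdivrMr// mulrAC ltr_pdivlMr// /E /G; nra.
apply: (@squeeze_cvgr _ _ _ _ (fun=> 0) (fun n => n%:R `^ (- (beta / E - D / G)))).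
- near=> n.
  have n0 : (0 < n)%N by near: n; exact: nbhs_infty_gt.
  have nR0 : 0 < n%:R :> R by rewrite ltr0n.
  have rg := rate_ge halpha hp hbeta n0 (tau0 n n0) Db.
  have r0 : 0 < rate alpha beta p tau n by apply: lt_le_trans rg; rewrite powR_gt0.
  rewrite divr_ge0 ?powR_ge0 ?(ltW r0)//= ler_pdivrMr//.
  apply: le_trans (ler_wpM2l (powR_ge0 _ _) rg).
  rewrite -powRD; last by rewrite (gt_eqF nR0) implybT.
  by rewrite opprB addrAC subrr add0r.
- exact: cvg_cst.
- exact: powRn_cvg0.
Unshelve. all: by end_near. Qed.

(** * Orthonormal bases and adjoints in Hilbert spaces *)

Lemma seq_limit_unique (R : realType) (V : normedModType R) (f : nat -> V) (l l' : V) :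
  f n @[n --> \oo] --> l -> f n @[n --> \oo] --> l' -> l = l'.
Proof.
by move=> /(cvg_lim (@norm_hausdorff _ _)) <- /(cvg_lim (@norm_hausdorff _ _)) <-.
Qed.

Section hilbert.
Context (R : realType) (H : completeNormedModType R) (ip : {dot H for idfun}).
Hypothesis hip : induces_norm ip.

Lemma ip_sym (x y : H) : ip x y = ip y x.
Proof. by rewrite hermC /= expr0 mul1r. Qed.

Lemma ipZr (a : R) (x y : H) : ip x (a *: y) = a * ip x y.
Proof. by rewrite linearZr_LR. Qed.

Lemma ipZl (a : R) (x y : H) : ip (a *: x) y = a * ip x y.
Proof. by rewrite linearZl_LR. Qed.

Lemma ipDl (x y z : H) : ip (x + y) z = ip x z + ip y z.
Proof. exact: linearDl. Qed.

Lemma ipBl (x y z : H) : ip (x - y) z = ip x z - ip y z.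
Proof. exact: linearBl. Qed.

Lemma ip_suml (I : Type) (r : seq I) (Q : pred I) (E : I -> H) (y : H) :
  ip (\sum_(i <- r | Q i) E i) y = \sum_(i <- r | Q i) ip (E i) y.
Proof. exact: linear_sumlz. Qed.

Lemma ip_sumr (I : Type) (r : seq I) (Q : pred I) (E : I -> H) (x : H) :
  ip x (\sum_(i <- r | Q i) E i) = \sum_(i <- r | Q i) ip x (E i).
Proof. exact: linear_sumr. Qed.

Lemma cauchy_schwarz (x y : H) : `|ip x y| <= `|x| * `|y|.
Proof.
have [->|y0] := eqVneq y 0; first by rewrite linear0r !normr0 mulr0.
have ny : 0 < `|y| by rewrite normr_gt0.
have n2y : 0 < `|y| ^+ 2 by rewrite exprn_gt0.
rewrite -(@ler_pXn2r _ 2)// ?nnegrE ?mulr_ge0// exprMn real_normK ?num_real//.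
set t := ip x y / `|y| ^+ 2.
have := sqr_ge0 (`|x - t *: y|); rewrite -hip.
rewrite linearBl !linearBr /= !ipZr !ipZl !hip (ip_sym y x).
have -> : ip x y = t * `|y| ^+ 2 by rewrite /t divfK// gt_eqF.
move=> h; rewrite -subr_ge0.
suff -> : `|x| ^+ 2 * `|y| ^+ 2 - (t * `|y| ^+ 2) ^+ 2 =
  (`|x| ^+ 2 - t * (t * `|y| ^+ 2) - (t * (t * `|y| ^+ 2) - t * (t * `|y| ^+ 2)))
   * `|y| ^+ 2 by rewrite mulr_ge0// ltW.
ring.
Qed.

Lemma ip_cvg (T : Type) (F : set_system T) {FF : Filter F} (f : T -> H) (x h : H) :
  f @ F --> x -> ip (f t) h @[t --> F] --> ip x h.
Proof.
move=> fx; apply/subr_cvg0.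
have hx : `|f t - x| * `|h| @[t --> F] --> (0 : R).
  rewrite -[X in _ --> X](mul0r `|h|); apply: cvgM; last exact: cvg_cst.
  by apply/norm_cvg0P; apply/subr_cvg0.
apply/norm_cvg0P; apply: (squeeze_cvgr _ (cvg_cst 0) hx).
near=> t; rewrite normr_ge0 /= -linearBl.
exact: cauchy_schwarz.
Unshelve. all: by end_near. Qed.

Lemma ip_continuous (h : H) : continuous (fun x => ip x h).
Proof. by move=> x; apply: ip_cvg. Qed.

Lemma ip_ext (x y : H) : (forall z, ip z x = ip z y) -> x = y.
Proof.
move=> xy; apply/eqP; rewrite -subr_eq0 -normr_eq0 -sqrf_eq0 -hip.
by rewrite linearBr /= xy subrr.
Qed.

Section basis.
Context (e : nat -> H) (he : orthonormal_basis ip e).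

Lemma basis_coef (a : nat -> R) (n i : nat) :
  ip (series (fun j => a j *: e j) n) (e i) = a i *+ (i < n)%N.
Proof.
rewrite /series /= big_mkord ip_suml.
under eq_bigr do rewrite ipZl he.1.
have [i_n|n_i] := ltnP i n.
  rewrite (bigD1 (Ordinal i_n))//= eqxx mulr1 big1 ?addr0// => j ji.
  have /negPf-> : nat_of_ord j != i by apply: contra ji => /eqP ji; apply/eqP/val_inj.
  by rewrite mulr0.
rewrite big1// => j _.
by rewrite ltn_eqF ?mulr0// (leq_trans (ltn_ord j)).
Qed.

Lemma basis_limit_coef (a : nat -> R) (x : H) (i : nat) :
  series (fun j => a j *: e j) @ \oo --> x -> ip x (e i) = a i.
Proof.
move=> ax.
have c1 : ip (series (fun j => a j *: e j) n) (e i) @[n --> \oo] --> ip x (e i).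
  exact: ip_cvg ax.
apply: (seq_limit_unique (V := R^o) c1).
apply: cvg_near_cst; near=> n; rewrite basis_coef.
by have -> : (i < n)%N by near: n; exact: nbhs_infty_gt.
Unshelve. all: by end_near. Qed.

Lemma basis_ext (x y : H) : (forall i, ip x (e i) = ip y (e i)) -> x = y.
Proof.
move=> xy; have := he.2 x; under [X in series X]eq_fun do rewrite xy.
move=> h; exact: (seq_limit_unique h (he.2 y)).
Qed.

Lemma parseval_cvg (x y : H) :
  \sum_(0 <= i < n) ip x (e i) * ip y (e i) @[n --> \oo] --> ip x y.
Proof.
have : ip (series (fun i => ip x (e i) *: e i) n) y @[n --> \oo] --> ip x y.
  exact: ip_cvg (he.2 x).
apply: cvg_trans; apply: near_eq_cvg.
near=> n; rewrite /series /= ip_suml; apply: eq_bigr => i _.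
by rewrite ipZl (ip_sym (e i)).
Unshelve. all: by end_near. Qed.

Lemma parseval (x : H) :
  (\sum_(0 <= i <oo) ((ip x (e i)) ^+ 2)%:E = (`|x| ^+ 2)%:E)%E.
Proof.
apply/cvg_lim => //.
have -> : (fun n => (\sum_(0 <= i < n) ((ip x (e i)) ^+ 2)%:E)%E) =
  (fun n => (\sum_(0 <= i < n) ip x (e i) * ip x (e i))%:E).
  by apply/funext => n; rewrite sumEFin; congr EFin; apply: eq_bigr => i _; rewrite expr2.
apply: cvg_EFin; first by near=> n.
by rewrite -hip; exact: parseval_cvg.
Unshelve. all: by end_near. Qed.

Lemma norm_series (a : nat -> R) (m n : nat) :
  `|\sum_(m <= i < n) a i *: e i| ^+ 2 = \sum_(m <= i < n) a i ^+ 2.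
Proof.
rewrite -hip ip_suml; apply: eq_big_seq => i; rewrite mem_index_iota => /andP[mi ni].
rewrite ipZl ip_sumr /=.
under eq_bigr do rewrite ipZr he.1.
rewrite (bigD1_seq i) ?iota_uniq ?mem_index_iota ?mi//= eqxx mulr1 big1 ?addr0//.
by move=> j /negPf; rewrite eq_sym => ->; rewrite mulr0.
Qed.

(** The squared norm of a block of the series is a block of the series of the
    [a i ^+ 2], so completeness of [H] turns bounded partial sums into
    convergence. *)
Lemma riesz_fischer (a : nat -> R) (B : R) :
  (forall n, \sum_(0 <= i < n) a i ^+ 2 <= B) ->
  cvg (series (fun i => a i *: e i) @ \oo).
Proof.
move=> aB.
apply: cauchy_cvg; apply/cauchy_seriesP => eps eps0.
have : cvgn (series (fun i => a i ^+ 2)).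
  apply: nondecreasing_is_cvgn.
    by apply: nondecreasing_series => i _ _; exact: sqr_ge0.
  by exists B => _ [n _ <-]; exact: aB.
move=> /cvg_cauchy /cauchy_seriesP /(_ (eps ^+ 2)).
rewrite exprn_gt0// => /(_ isT); apply: filterS => -[m n] /=.
rewrite -norm_series normrX normr_id => h.
by rewrite -(@ltr_pXn2r _ 2) ?nnegrE// ltW.
Qed.

End basis.
End hilbert.

Section adjoints.
Context (R : realType) (H1 H2 : completeNormedModType R).
Context (ip1 : {dot H1 for idfun}) (ip2 : {dot H2 for idfun}).
Hypotheses (hip1 : induces_norm ip1) (hip2 : induces_norm ip2).

Lemma adjoint_unique (T : H1 -> H2) (y : H2) (x : H1) :
  (forall z, ip2 (T z) y = ip1 z x) -> adjoint ip1 ip2 T y = x.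
Proof.
move=> Tx; apply: (ip_ext hip1) => z; rewrite -Tx; apply/esym.
have : [set x | forall z, ip2 (T z) y = ip1 z x] (adjoint ip1 ip2 T y).
  by apply: xgetPex; exists x.
exact.
Qed.

(** Existence of the adjoint (Riesz). The representing vector has the
    coordinates [ip2 (K (e i)) y]; they are square summable because the partial
    sum [v] satisfies [`|v| ^+ 2 = ip2 (K v) y <= B * `|v| * `|y|]. *)
Lemma adjointP (e : nat -> H1) (he : orthonormal_basis ip1 e)
    (K : {linear H1 -> H2}) (hK : continuous K) (y : H2) (z : H1) :
  ip2 (K z) y = ip1 z (adjoint ip1 ip2 K y).
Proof.
suff [x Kx] : exists x, forall z, ip2 (K z) y = ip1 z x.
  by rewrite (adjoint_unique Kx).
have [B B0 KB] : exists2 B, 0 < B & forall z, `|K z| <= B * `|z|.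
  have := (linear_bounded_continuous K).2 hK => /linear_boundedP hB.
  near (pinfty_nbhs R) => B; exists B; first by near: B; exact: nbhs_pinfty_gt.
  by near: B.
pose a i := ip2 (K (e i)) y.
have aB n : \sum_(0 <= i < n) a i ^+ 2 <= (B * `|y|) ^+ 2.
  rewrite -(norm_series hip1 he); set v := \sum_(_ <= _ < _) _.
  have vE : `|v| ^+ 2 = ip2 (K v) y.
    rewrite (norm_series hip1 he) /v linear_sum /= ip_suml.
    by apply: eq_bigr => i _; rewrite linearZ ipZl expr2.
  apply: lerXn2r; rewrite ?nnegrE ?mulr_ge0 ?(ltW B0)//.
  have [->|v0] := eqVneq v 0; first by rewrite normr0 mulr_ge0// ltW.
  have nv : 0 < `|v| by rewrite normr_gt0.
  rewrite -(ler_pM2r nv) -expr2 vE.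
  apply: (le_trans (ler_norm _)); apply: (le_trans (cauchy_schwarz hip2 _ _)).
  by rewrite mulrAC ler_wpM2r.
have cvga := riesz_fischer hip1 he aB.
exists (lim (series (fun i => a i *: e i) @ \oo)) => {}z.
have Kz : ip2 (K (series (fun i => ip1 z (e i) *: e i) n)) y @[n --> \oo] --> ip2 (K z) y.
  by apply: ip_cvg => //; exact: (cvg_comp _ _ (he.2 z) (hK z)).
apply: (seq_limit_unique (V := R^o) Kz).
have := parseval_cvg hip1 he (x := z) (y := lim (series (fun i => a i *: e i) @ \oo)).
apply: cvg_trans; apply: near_eq_cvg; near=> n.
rewrite /= /series /= linear_sum ip_suml; apply: eq_bigr => i _.
by rewrite linearZ ipZl (basis_limit_coef hip1 he i cvga).
Unshelve. all: by end_near. Qed.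

End adjoints.

(** * The posterior in the common eigenbasis *)

Lemma bessel (R : realType) (H : completeNormedModType R)
    (ip : {dot H for idfun}) (hip : induces_norm ip)
    (e : nat -> H) (he : orthonormal_basis ip e) (x : H) (m : nat) :
  \sum_(0 <= i < m) ip x (e i) ^+ 2 <= `|x| ^+ 2.
Proof.
rewrite -lee_fin -(parseval hip he) -sumEFin.
by apply: nneseries_lim_ge => i _ _; rewrite lee_fin sqr_ge0.
Qed.

Section conjugate_posterior.
Context (R : realType) (H1 H2 : completeNormedModType R).
Context (ip1 : {dot H1 for idfun}) (ip2 : {dot H2 for idfun}).
Hypotheses (hip1 : induces_norm ip1) (hip2 : induces_norm ip2).
Context (e : nat -> H1) (he : orthonormal_basis ip1 e).
Context (K : {linear H1 -> H2}) (hK : continuous K).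
Context (Lam : {linear H1 -> H1}) (hLam : continuous Lam).
Context (k lam : nat -> R) (n : nat).
Hypothesis hKe : forall i, adjoint ip1 ip2 K (K (e i)) = k i *: e i.
Hypothesis hLame : forall i, Lam (e i) = lam i *: e i.
Hypotheses (hlam : forall i, 0 <= lam i) (hn : (0 < n)%N).

Let Kt : H2 -> H1 := adjoint ip1 ip2 K.

Lemma ip_forward_basis (z : H1) (i : nat) :
  ip2 (K z) (K (e i)) = k i * ip1 z (e i).
Proof. by rewrite (adjointP hip1 hip2 he hK) hKe ipZr. Qed.

Lemma ip_adjoint_basis (y : H2) (i : nat) : ip1 (Kt y) (e i) = ip2 y (K (e i)).
Proof. by rewrite ip_sym -(adjointP hip1 hip2 he hK) ip_sym. Qed.

Lemma ip_diagonal_basis (x : H1) (i : nat) :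
  ip1 (Lam x) (e i) = lam i * ip1 x (e i).
Proof.
rewrite mulrC; apply: (basis_limit_coef hip1 he (a := fun j => ip1 x (e j) * lam j)).
have := cvg_comp _ _ (he.2 x) (hLam (x := x)).
apply: cvg_trans; apply: near_eq_cvg; near=> m.
rewrite /= /series /= linear_sum; apply: eq_bigr => j _.
by rewrite linearZ /= hLame scalerA.
Unshelve. all: by end_near. Qed.

Lemma eigenvalue_ge0 (i : nat) : 0 <= k i.
Proof.
have := ip_forward_basis (e i) i; rewrite he.1 eqxx mulr1 => <-.
by rewrite hip2 sqr_ge0.
Qed.

Let dn i := n%:R^-1 + lam i * k i.

Let n_gt0 : 0 < n%:R :> R. Proof. by rewrite ltr0n. Qed.

Let lamk_ge0 i : 0 <= lam i * k i.
Proof. by rewrite mulr_ge0// eigenvalue_ge0. Qed.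

Let dn_gt0 i : 0 < dn i.
Proof. by rewrite /dn ltr_wpDr ?invr_gt0. Qed.

(** The preimage of [z] can be written down: if [v] solves
    [(n^-1 + K^T K Lam) v = K^T z], which is a diagonal system in the basis
    [e], then [u = n (z - K (Lam v))] satisfies [K^T u = v]. This is what makes
    [pinv] a genuine right inverse in the definition of the gain. *)
Lemma data_covariance_surj (z : H2) :
  exists u, data_covariance ip1 ip2 K Lam n u = z.
Proof.
pose a i := (dn i)^-1 * ip1 (Kt z) (e i).
have aB m : \sum_(0 <= i < m) a i ^+ 2 <= n%:R ^+ 2 * `|Kt z| ^+ 2.
  apply: (@le_trans _ _ (n%:R ^+ 2 * \sum_(0 <= i < m) ip1 (Kt z) (e i) ^+ 2)).
    rewrite mulr_sumr; apply: ler_sum => i _.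
    rewrite /a exprMn ler_wpM2r ?sqr_ge0//.
    apply: lerXn2r; rewrite ?nnegrE ?invr_ge0 ?(ltW (dn_gt0 i)) ?(ltW n_gt0)//.
    by rewrite invf_ple ?posrE// /dn lerDl.
  by rewrite ler_wpM2l ?sqr_ge0// (bessel hip1 he).
have cva := riesz_fischer hip1 he aB.
set v := lim (series (fun i => a i *: e i) @ \oo) in cva *.
have ve i : ip1 v (e i) = a i by exact: (basis_limit_coef hip1 he i cva).
exists (n%:R *: (z - K (Lam v))).
rewrite /data_covariance scalerA mulVf ?gt_eqF// scale1r.
suff -> : adjoint ip1 ip2 K (n%:R *: (z - K (Lam v))) = v by rewrite subrK.
apply: (basis_ext he) => i.
rewrite ip_adjoint_basis ipZl ipBl ip_forward_basis ip_diagonal_basis.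
rewrite -ip_adjoint_basis ve.
have -> : ip1 (Kt z) (e i) = dn i * a i by rewrite /a mulrA divff ?mul1r// gt_eqF.
rewrite mulrA [k i * _]mulrC -mulrBl /dn addrK mulrA divff ?mul1r// gt_eqF//.
Qed.

(** This is n lam_i / (1 + n lam_i k_i), the weight of the observation in the
    i-th coordinate of the posterior mean. *)
Definition shrinkage (i : nat) : R := lam i / (n%:R^-1 + lam i * k i).

(** Pairing [data_covariance u = y] with [K (e i)] gives a scalar equation for
    the i-th coefficient of [u], because [K (e i)] is an eigenvector of the
    data covariance. *)
Lemma posterior_gain_coef (y : H2) (i : nat) :
  ip1 (posterior_gain ip1 ip2 K Lam n y) (e i) =
  ip2 y (shrinkage i *: K (e i)).
Proof.
rewrite /posterior_gain.
set u := pinv _ _ _.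
have Du : data_covariance ip1 ip2 K Lam n u = y.
  by apply: pinvK; rewrite inE /=; have [w <-] := data_covariance_surj y; exists w.
rewrite ip_diagonal_basis ip_adjoint_basis ipZr -[in RHS]Du /data_covariance.
rewrite ipDl ipZl ip_forward_basis ip_diagonal_basis ip_adjoint_basis.
rewrite mulrA [k i * _]mulrC -mulrDl mulrA; congr (_ * _).
by rewrite /shrinkage divfK// gt_eqF// dn_gt0.
Qed.

Lemma adjoint_gain (i : nat) :
  adjoint ip2 ip1 (posterior_gain ip1 ip2 K Lam n) (e i) = shrinkage i *: K (e i).
Proof. by apply: adjoint_unique => // y; exact: posterior_gain_coef. Qed.

Lemma posterior_variance_coef (i : nat) :
  ip1 (posterior_covariance ip1 ip2 K Lam n (e i)) (e i) =
  lam i / (1 + n%:R * lam i * k i).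
Proof.
rewrite /posterior_covariance ipBl posterior_gain_coef adjoint_gain.
rewrite ip_diagonal_basis he.1 eqxx mulr1 !ipZr /data_covariance ipDl !ipZl.
rewrite !ip_forward_basis ip_diagonal_basis ip_adjoint_basis ipZl ip_forward_basis.
rewrite he.1 eqxx mulr1 /shrinkage.
have n0 : n%:R != 0 :> R by rewrite gt_eqF.
have nd : n%:R^-1 + lam i * k i != 0 by rewrite gt_eqF// dn_gt0.
have nd' : 1 + n%:R * lam i * k i != 0.
  by rewrite gt_eqF// ltr_wpDr// -mulrA mulr_ge0// ltW.
by field; rewrite n0 nd'.
Qed.

End conjugate_posterior.

(** * Second moments of the normal law *)

Section density.
Context d (T : measurableType d) (R : realType).
Context (mu nu : {measure set T -> \bar R}) (f : T -> R).
Hypotheses (mf : measurable_fun setT f) (f0 : forall x, 0 <= f x).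
Hypothesis nuE : forall A, measurable A -> nu A = (\int[mu]_(x in A) (f x)%:E)%E.

Import HBNNSimple.
Local Open Scope ereal_scope.

Let mEf : measurable_fun setT (EFin \o f).
Proof. exact/measurable_EFinP. Qed.

Let integral_density_indic (A : set T) : measurable A ->
  \int[nu]_x (\1_A x)%:E = \int[mu]_x ((\1_A x)%:E * (f x)%:E).
Proof.
move=> mA; rewrite integral_indic// setIT nuE// integral_mkcond.
apply: eq_integral => x _; rewrite patchE indicE.
by case: ifPn => _; rewrite ?mul1e ?mul0e.
Qed.

Let integral_density_nnsfun (g : {nnsfun T >-> R}) :
  \int[nu]_x (g x)%:E = \int[mu]_x ((g x)%:E * (f x)%:E).
Proof.
under [LHS]eq_integral do rewrite fimfunE -fsumEFin//.
rewrite [LHS]ge0_integral_fsum//; last 2 first.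
- by move=> r; exact/measurable_EFinP/measurableT_comp.
- by move=> r x _; rewrite EFinM nnfun_muleindic_ge0.
under [RHS]eq_integral.
  move=> x xD; rewrite fimfunE -fsumEFin// muleC ge0_mule_fsumr; last first.
    by move=> r; rewrite EFinM nnfun_muleindic_ge0.
  over.
rewrite [RHS]ge0_integral_fsum//; last 2 first.
- move=> r; apply: emeasurable_funM => //.
  exact/measurable_EFinP/measurableT_comp.
- move=> r x _; apply: mule_ge0; first by rewrite lee_fin.
  by rewrite EFinM nnfun_muleindic_ge0.
apply: eq_fsbigr => r _.
rewrite integralZl_indic_nnsfun//= integral_density_indic//.
have [r0|r0] := leP 0%R r.
  rewrite -ge0_integralZl//; last 2 first.
  - by apply: emeasurable_funM => //; exact/measurable_EFinP/measurable_indic.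
  - by move=> x _; rewrite mule_ge0// lee_fin.
  by apply: eq_integral => x _; rewrite EFinM muleA muleC.
(* A nonnegative simple function does not take the value r < 0. *)
have g_r : g @^-1` [set r] = set0.
  by apply/seteqP; split => // x /= gxr; move: r0; rewrite -gxr ltNge fun_ge0.
rewrite g_r; under eq_integral do rewrite indic0 mul0e.
rewrite integral0 mule0; apply/esym/integral0_eq => x _.
by rewrite indic0 mulr0 mule0.
Qed.

(** Passing from sets to nonnegative functions: indicators, then simple
    functions by linearity, then monotone convergence. *)
Lemma ge0_integral_density (g : T -> \bar R) :
  measurable_fun setT g -> (forall x, 0 <= g x) ->
  \int[nu]_x g x = \int[mu]_x (g x * (f x)%:E).
Proof.
move=> mg g0; pose g_ := nnsfun_approx measurableT mg.
have gE x : limn (fun n => (g_ n x)%:E) = g x.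
  by apply/cvg_lim => //; exact: cvg_nnsfun_approx.
transitivity (limn (fun n => \int[nu]_x (g_ n x)%:E)).
  rewrite -monotone_convergence//=.
  - by apply: eq_integral => x _; rewrite gE.
  - by move=> n; exact/measurable_EFinP.
  - by move=> n x _; rewrite lee_fin.
  - by move=> x _ m n mn; rewrite lee_fin; exact/lefP/nd_nnsfun_approx.
under eq_fun do rewrite integral_density_nnsfun.
rewrite -monotone_convergence//=.
- apply: eq_integral => x _; apply/cvg_lim => //.
  under eq_fun do rewrite muleC; rewrite muleC.
  by apply: cvgeZl => //; exact: cvg_nnsfun_approx.
- by move=> n; apply: emeasurable_funM => //; exact/measurable_EFinP.
- by move=> n x _; rewrite mule_ge0// lee_fin.
- move=> x _ m n mn; rewrite lee_wpmul2r ?lee_fin//.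
  exact/lefP/nd_nnsfun_approx.
Qed.

End density.

(** A quadratic factor is absorbed by doubling the standard deviation: with
    [t = (x - m) ^+ 2 / (8 * s ^+ 2)] the claim is [t * exp (- 4 t) <= exp (- t)].
    Integrated, it bounds the variance of the normal law up to a numerical
    factor, which is all that a rate of contraction requires. *)
Lemma normal_pdf_sqr_le (R : realType) (m s x : R) : 0 < s ->
  (x - m) ^+ 2 * normal_pdf m s x <= 16 * s ^+ 2 * normal_pdf m (2 * s) x.
Proof.
move=> s0; rewrite !normal_pdfE ?mulf_neq0 ?gt_eqF//.
have -> : normal_peak s = 2 * normal_peak (2 * s).
  have E : (2 * s) ^+ 2 * pi *+ 2 = 2 ^+ 2 * (s ^+ 2 * pi *+ 2) by ring.
  rewrite /normal_peak E [in RHS]sqrtrM ?sqr_ge0// sqrtr_sqr.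
  by rewrite ger0_norm// invfM mulrA divff ?mul1r.
have s2 : 0 < s ^+ 2 by rewrite exprn_gt0.
set t := (x - m) ^+ 2 / (8 * s ^+ 2).
have t0 : 0 <= t by rewrite divr_ge0 ?sqr_ge0 ?mulr_ge0 ?ltW.
have xE : (x - m) ^+ 2 = 8 * s ^+ 2 * t.
  by rewrite /t mulrC divfK// gt_eqF// mulr_gt0.
have ns : s != 0 by rewrite gt_eqF.
have -> : normal_fun m s x = expR (- t) * expR (- t * 3).
  rewrite -expRD /normal_fun; congr expR; rewrite mulNr xE.
  by field.
have -> : normal_fun m (2 * s) x = expR (- t).
  rewrite /normal_fun; congr expR; rewrite mulNr xE; by field.
have te : t * expR (- t * 3) <= 1.
  have -> : - t * 3 = - (3 * t) by rewrite mulNr mulrC.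
  rewrite expRN ler_pdivrMr ?expR_gt0// mul1r.
  by apply: le_trans (expR_ge1Dx _); lra.
rewrite xE.
have -> : 8 * s ^+ 2 * t * (2 * normal_peak (2 * s) * (expR (- t) * expR (- t * 3)))
  = 16 * s ^+ 2 * (normal_peak (2 * s) * expR (- t)) * (t * expR (- t * 3)) by ring.
by rewrite ler_piMr// !mulr_ge0 ?normal_peak_ge0 ?expR_ge0// ltW.
Qed.

Lemma normal_prob_sqr_le (R : realType) (m s : R) : 0 < s ->
  (\int[normal_prob m s]_x ((x - m) ^+ 2)%:E <= (16 * s ^+ 2)%:E)%E.
Proof.
move=> s0.
have mp s' : measurable_fun setT (normal_pdf m s') by exact: measurable_normal_pdf.
have mx : measurable_fun setT (fun x : R => (x - m) ^+ 2).
  by apply: measurable_funX; exact: measurable_funB.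
rewrite (@ge0_integral_density _ _ _ lebesgue_measure (normal_prob m s) (normal_pdf m s))//.
- apply: (@le_trans _ _ (\int[lebesgue_measure]_x
      ((16 * s ^+ 2)%:E * (normal_pdf m (2 * s) x)%:E))%E).
    apply: ge0_le_integral => //=.
    + by move=> x _; rewrite -EFinM lee_fin mulr_ge0 ?sqr_ge0 ?normal_pdf_ge0.
    + by apply: emeasurable_funM; apply/measurable_EFinP; [exact: mx|exact: mp].
    + by apply: emeasurable_funM => //; apply/measurable_EFinP; exact: mp.
    + by move=> x _; rewrite -!EFinM lee_fin; exact: normal_pdf_sqr_le.
  rewrite ge0_integralZl//=.
  + by rewrite integral_normal_pdf mule1.
  + by apply/measurable_EFinP; exact: mp.
  + by move=> x _; rewrite lee_fin normal_pdf_ge0.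
  + by rewrite lee_fin mulr_ge0 ?sqr_ge0.
- exact: mp.
- exact: normal_pdf_ge0.
- exact/measurable_EFinP.
- by move=> x; rewrite lee_fin sqr_ge0.
Qed.

(** * Markov bounds for Gaussian measures and white noise *)

Lemma sqr_subr_le (R : realType) (x m c : R) :
  (x - c) ^+ 2 <= 2 * (x - m) ^+ 2 + 2 * (m - c) ^+ 2.
Proof.
rewrite -subr_ge0; apply: le_trans (sqr_ge0 (x - m - (m - c))) _.
by rewrite le_eqVlt; apply/orP; left; apply/eqP; ring.
Qed.

(** Moves the centre of a second moment, at the price of a factor 2, without
    computing a cross term. *)
Lemma prob_sqr_sub_le d (T : measurableType d) (R : realType)
    (P : probability T R) (X : T -> R) (m c v : R) : measurable_fun setT X ->
  (\int[P]_w ((X w - m) ^+ 2)%:E <= v%:E)%E ->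
  (\int[P]_w ((X w - c) ^+ 2)%:E <= (2 * v + 2 * (m - c) ^+ 2)%:E)%E.
Proof.
move=> mX Xv.
have mXs a : measurable_fun setT (fun w => ((X w - a) ^+ 2)%:E).
  by apply/measurable_EFinP; apply: measurable_funX; exact: measurable_funB.
apply: (@le_trans _ _
  (\int[P]_w (2%:E * ((X w - m) ^+ 2)%:E + (2 * (m - c) ^+ 2)%:E))%E).
  apply: ge0_le_integral => //=.
  - by move=> w _; rewrite lee_fin sqr_ge0.
  - by apply: emeasurable_funD => //; apply: emeasurable_funM.
  - by move=> w _; rewrite -EFinM -EFinD lee_fin sqr_subr_le.
rewrite ge0_integralD//=.
- rewrite ge0_integralZl//=; last by move=> w _; rewrite lee_fin sqr_ge0.
  rewrite integral_cst//= probability_setT mule1 [X in (_ <= X)%E]EFinD; apply: leeD => //.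
  by rewrite EFinM lee_wpmul2l.
- by move=> w _; rewrite -EFinM lee_fin mulr_ge0 ?sqr_ge0.
- by apply: emeasurable_funM.
- by move=> w _; rewrite lee_fin mulr_ge0 ?sqr_ge0.
Qed.

(** Integrals of [f \o X] depend only on the law of [X], which is given here
    by its values on measurable sets. *)
Lemma law_integral d (T : measurableType d) (R : realType)
    (nu : {measure set T -> \bar R}) (X : T -> R)
    (N : {measure set (measurableTypeR R) -> \bar R}) (f : R -> \bar R) :
  measurable_fun setT (X : T -> measurableTypeR R) ->
  (forall A, measurable A -> nu (X @^-1` A) = N A) ->
  measurable_fun setT (f : measurableTypeR R -> \bar R) -> (forall x, 0 <= f x)%E ->
  (\int[nu]_w f (X w) = \int[N]_x f x)%E.
Proof.
move=> mX XN mf f0.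
pose X' : {mfun T >-> measurableTypeR R} := HB.pack X (isMeasurableFun.Build _ _ _ _ _ mX).
transitivity (\int[pushforward nu X']_x f x)%E.
  by rewrite (ge0_integral_pushforward mX).
by apply: eq_measure_integral => A mA _; rewrite -XN.
Qed.

Lemma normally_distributed_sqr_le d (T : measurableType d) (R : realType)
    (nu : {measure set T -> \bar R}) (X : T -> R) (m v c : R) :
  measurable_fun setT X -> 0 < v -> normally_distributed nu X m v ->
  (\int[nu]_w ((X w - c) ^+ 2)%:E <= (32 * v + 2 * (m - c) ^+ 2)%:E)%E.
Proof.
move=> mX v0 [_ Xd].
have mx : measurable_fun setT (fun x : R => ((x - c) ^+ 2)%:E).
  by apply/measurable_EFinP; apply: measurable_funX; exact: measurable_funB.
have -> : (\int[nu]_w ((X w - c) ^+ 2)%:E =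
           \int[normal_prob m (Num.sqrt v)]_x ((x - c) ^+ 2)%:E)%E.
  apply: (@law_integral _ _ _ _ _ (normal_prob m (Num.sqrt v))
    (fun x => ((x - c) ^+ 2)%:E)) => //.
  - by move=> A mA; rewrite Xd// gt_eqF.
  - by move=> x; rewrite lee_fin sqr_ge0.
have -> : 32 * v = 2 * (16 * v) by ring.
apply: (@prob_sqr_sub_le _ _ _ (normal_prob m (Num.sqrt v)) id) => //.
have := @normal_prob_sqr_le R m (Num.sqrt v).
by rewrite sqrtr_gt0 v0 sqr_sqrtr ?(ltW v0)// => /(_ isT).
Qed.

Section borel_hilbert.
Context (R : realType) (H : completeNormedModType R).

Lemma continuous_borel_measurable (f : H -> R) : continuous f ->
  measurable_fun setT (f : borel H -> R).
Proof.
move=> cf; apply: (measurability _ (RGenOpens.measurableE R)).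
move=> _ [_ [a [b ->]] <-]; rewrite setTI.
apply: sub_sigma_algebra; apply: open_comp => // x _; exact: cf.
Qed.

Lemma measurable_outside_ball (mu0 : H) (r : R) :
  measurable ([set mu : H | r <= `|mu - mu0|] : set (borel H)).
Proof.
have mf : measurable_fun setT ((fun mu : H => `|mu - mu0|) : borel H -> R).
  apply: continuous_borel_measurable => x.
  by apply: cvg_norm; apply: cvgB; [exact: cvg_id|exact: cvg_cst].
have -> : [set mu : H | r <= `|mu - mu0|] =
    setT `&` ((fun mu : H => `|mu - mu0|) @^-1` `[r, +oo[).
  by rewrite setTI; apply/seteqP; split => x /=; rewrite in_itv/= andbT.
by apply: mf => //; exact: measurable_itv.
Qed.

Context (ip : {dot H for idfun}).
Hypothesis hip : induces_norm ip.
Context (e : nat -> H) (he : orthonormal_basis ip e).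

(** Markov's inequality for the squared norm, which Parseval writes as a sum of
    squares of one-dimensional Gaussian variables. *)
Lemma gaussian_mass_le (nu : {measure set (borel H) -> \bar R}) (m : H)
    (S : H -> H) (mu0 : H) (r : R) : 0 <= r ->
  (forall i, 0 < ip (S (e i)) (e i)) -> gaussian_measure ip nu m S ->
  ((r ^+ 2)%:E * nu [set mu : H | (r <= `|mu - mu0|)%R] <=
   \sum_(0 <= i <oo) (32 * ip (S (e i)) (e i) +
                      2 * (ip m (e i) - ip mu0 (e i)) ^+ 2)%:E)%E.
Proof.
move=> r0 S0 G.
have mip i : measurable_fun setT ((fun mu => ip mu (e i)) : borel H -> R).
  by apply: continuous_borel_measurable; exact: ip_continuous.
have mc i : measurable_fun setT
    ((fun mu => ((ip mu (e i) - ip mu0 (e i)) ^+ 2)%:E) : borel H -> \bar R).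
  by apply/measurable_EFinP; apply: measurable_funX; exact: measurable_funB.
have mU := measurable_outside_ball mu0 r.
apply: (@le_trans _ _ (\int[nu]_mu
  (\sum_(0 <= i <oo) ((ip mu (e i) - ip mu0 (e i)) ^+ 2)%:E))%E).
  set U := [set mu : H | _] in mU *.
  have mI : measurable_fun setT (fun mu : borel H => (\1_U mu)%:E : \bar R).
    exact/measurable_EFinP/measurable_indic.
  have -> : ((r ^+ 2)%:E * nu U = \int[nu]_mu ((r ^+ 2)%:E * (\1_U mu)%:E))%E.
    rewrite ge0_integralZl//=.
    - by rewrite integral_indic// setIT.
    - by rewrite lee_fin sqr_ge0.
  apply: ge0_le_integral => //=.
  - by move=> mu _; rewrite -EFinM lee_fin mulr_ge0 ?sqr_ge0.
  - by apply: emeasurable_funM.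
  - apply: ge0_emeasurable_sum => // i mu _ _; by rewrite lee_fin sqr_ge0.
  - move=> mu _.
    under eq_eseriesr do rewrite -ipBl.
    rewrite (parseval hip he) -EFinM lee_fin indicE.
    have [|_] := boolP (_ \in _); last by rewrite mulr0 sqr_ge0.
    by rewrite inE /= mulr1 => h; apply: lerXn2r => //; rewrite nnegrE.
rewrite integral_nneseries//; last by move=> i mu _; rewrite lee_fin sqr_ge0.
apply: lee_nneseries => i _.
  by move=> _; apply: integral_ge0 => mu _; rewrite lee_fin sqr_ge0.
exact: normally_distributed_sqr_le (G (e i)).
Qed.

End borel_hilbert.

Lemma white_noise_sqr_le d (Omega : measurableType d) (R : realType)
    (H : completeNormedModType R) (ip : {dot H for idfun})
    (P : probability Omega R) (Y : H -> {mfun Omega >-> R}) (theta : H)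
    (n : nat) (h : H) (c : R) : white_noise_model ip P Y theta n ->
  (\int[P]_w ((Y h w - c) ^+ 2)%:E <=
   (2 * (n%:R^-1 * ip h h) + 2 * (ip theta h - c) ^+ 2)%:E)%E.
Proof.
move=> [_ EY VY]; apply: prob_sqr_sub_le => //.
by rewrite -VY covariance.unlock EY /= expectation.unlock.
Qed.

(** * The expected posterior mass as a sum of coordinate risks *)

Section posterior_risk.
Context (R : realType) (H1 H2 : completeNormedModType R).
Context (ip1 : {dot H1 for idfun}) (ip2 : {dot H2 for idfun}).
Hypotheses (hip1 : induces_norm ip1) (hip2 : induces_norm ip2).
Context (e : nat -> H1) (he : orthonormal_basis ip1 e).
Context (K : {linear H1 -> H2}) (hK : continuous K).
Context (Lam : {linear H1 -> H1}) (hLam : continuous Lam).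
Context (k lam : nat -> R) (n : nat).
Hypothesis hKe : forall i, adjoint ip1 ip2 K (K (e i)) = k i *: e i.
Hypothesis hLame : forall i, Lam (e i) = lam i *: e i.
Hypotheses (hlam : forall i, 0 < lam i) (hn : (0 < n)%N).
Context d (Omega : measurableType d) (P : probability Omega R).
Context (Y : H2 -> {mfun Omega >-> R}) (mu0 : H1).
Hypothesis hY : white_noise_model ip2 P Y (K mu0) n.
Context (AY : Omega -> H1).
Hypothesis hAYmeas : measurable_fun [set: Omega] (AY : Omega -> borel H1).
Hypothesis hAY : represents_image ip1 ip2 P Y (posterior_gain ip1 ip2 K Lam n) AY.
Context (post : R.-pker Omega ~> borel H1).
Hypothesis hpostN : forall w,
  gaussian_measure ip1 (post w) (AY w) (posterior_covariance ip1 ip2 K Lam n).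

Let hlam0 i : 0 <= lam i. Proof. exact: ltW. Qed.
Let k0 i : 0 <= k i. Proof. exact: (eigenvalue_ge0 hip1 hip2 he hK hKe). Qed.
Let u i := n%:R * lam i * k i.
Let s i := lam i / (1 + u i).
Let u0 i : 0 <= u i.
Proof. by rewrite /u !mulr_ge0. Qed.
Let u1_gt0 i : 0 < 1 + u i.
Proof. by rewrite ltr_wpDr. Qed.

Let varE i : ip1 (posterior_covariance ip1 ip2 K Lam n (e i)) (e i) = s i.
Proof. exact: (posterior_variance_coef hip1 hip2 he hK hLam hKe hLame). Qed.

Let mAYi i : measurable_fun setT (fun w => ip1 (AY w) (e i)).
Proof.
have mi := continuous_borel_measurable (ip_continuous hip1 (h := e i)).
exact: measurableT_comp mi hAYmeas.
Qed.

(** The i-th coordinate of the posterior mean is almost surely the observation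
    in direction [a *: K (e i)], where [a] is the shrinkage weight. Its variance
    is [s i * (u i / (1 + u i))] and its bias [- ip1 mu0 (e i) / (1 + u i)]. *)
Lemma posterior_mean_risk_le (i : nat) :
  (\int[P]_w ((ip1 (AY w) (e i) - ip1 mu0 (e i)) ^+ 2)%:E <=
   (2 * s i + 2 * (ip1 mu0 (e i) ^+ 2 * (1 + u i)^-1 ^+ 2))%:E)%E.
Proof.
set a := shrinkage k lam n i.
have -> : (\int[P]_w ((ip1 (AY w) (e i) - ip1 mu0 (e i)) ^+ 2)%:E =
    \int[P]_w ((Y (a *: K (e i)) w - ip1 mu0 (e i)) ^+ 2)%:E)%E.
  apply: ge0_ae_eq_integral => //=.
  - by apply/measurable_EFinP; apply: measurable_funX; exact: measurable_funB.
  - by apply/measurable_EFinP; apply: measurable_funX; exact: measurable_funB.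
  - by move=> w _; rewrite lee_fin sqr_ge0.
  - by move=> w _; rewrite lee_fin sqr_ge0.
  - have := hAY (e i).
    rewrite (adjoint_gain hip1 hip2 he hK hLam hKe hLame hlam0 hn).
    by apply: filterS => w /= -> _.
apply: (le_trans (white_noise_sqr_le _ _ hY)); rewrite lee_fin.
rewrite !ipZr !ipZl !(ip_forward_basis hip1 hip2 he hK hKe) he.1 eqxx mulr1.
have nR : 0 < n%:R :> R by rewrite ltr0n.
have nn : n%:R != 0 :> R by rewrite gt_eqF.
have aE : a = n%:R * s i.
  rewrite /a /shrinkage /s /u.
  have nd : 1 + n%:R * lam i * k i != 0 by rewrite gt_eqF// u1_gt0.
  by field; rewrite nn nd.
apply: lerD; rewrite ler_pM2l//.
- rewrite aE; have -> : n%:R^-1 * (n%:R * s i * (n%:R * s i * k i)) =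
    s i * (n%:R * s i * k i) by field.
  rewrite ler_piMr//; first by rewrite /s divr_ge0// ltW.
  have -> : n%:R * s i * k i = u i / (1 + u i) by rewrite /s /u; ring.
  by rewrite ler_pdivrMr// mul1r lerDr.
- have -> : a * (k i * ip1 mu0 (e i)) - ip1 mu0 (e i) =
    - (ip1 mu0 (e i) * (1 + u i)^-1).
    have nd : 1 + n%:R * lam i * k i != 0 by rewrite gt_eqF// u1_gt0.
    by rewrite aE /s /u; field.
  by rewrite sqrrN exprMn.
Qed.

(** The 36 is 32 for the spread of the posterior around its mean plus 4 for the
    sampling variance of that mean, which is at most the posterior variance;
    the squared bias is doubled by each of the two changes of centre. *)
Lemma expected_posterior_mass_le (r : R) : 0 <= r ->
  ((r ^+ 2)%:E * expected_posterior_mass P post mu0 r <=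
   \sum_(0 <= i <oo) (36 * (lam i / (1 + n%:R * lam i * k i)))%:E +
   \sum_(0 <= i <oo)
     (4 * (ip1 mu0 (e i) ^+ 2 * (1 + n%:R * lam i * k i)^-1 ^+ 2))%:E)%E.
Proof.
move=> r0.
have mU := measurable_outside_ball mu0 r.
have mpost := @measurable_kernel _ _ _ _ _ post _ mU.
have s0 i : 0 < s i by rewrite /s divr_gt0.
have mG i : measurable_fun setT (fun w =>
    (32 * s i + 2 * (ip1 (AY w) (e i) - ip1 mu0 (e i)) ^+ 2)%:E : \bar R).
  apply/measurable_EFinP; apply: measurable_funD => //.
  by apply: measurable_funM => //; apply: measurable_funX; exact: measurable_funB.
have G0 i w : (0 <= (32 * s i + 2 * (ip1 (AY w) (e i) - ip1 mu0 (e i)) ^+ 2)%:E)%E.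
  by rewrite lee_fin; apply: addr_ge0; apply: mulr_ge0 => //; [exact: ltW|exact: sqr_ge0].
apply: (@le_trans _ _ (\int[P]_w (\sum_(0 <= i <oo)
  (32 * s i + 2 * (ip1 (AY w) (e i) - ip1 mu0 (e i)) ^+ 2)%:E))%E).
  rewrite /expected_posterior_mass -ge0_integralZl//; last first.
    by rewrite lee_fin sqr_ge0.
  apply: ge0_le_integral => //=.
  - by move=> w _; rewrite mule_ge0// lee_fin sqr_ge0.
  - by apply: emeasurable_funM.
  - by apply: ge0_emeasurable_sum.
  - move=> w _.
    have := gaussian_mass_le hip1 he mu0 r0 _ (hpostN w).
    under eq_eseriesr do rewrite varE.
    by apply => i; rewrite varE.
rewrite integral_nneseries// -nneseriesD; last 2 first.
- by move=> i _ _; rewrite lee_fin; apply: mulr_ge0 => //; exact: ltW (s0 i).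
- by move=> i _ _; rewrite lee_fin; apply: mulr_ge0 => //; apply: mulr_ge0; exact: sqr_ge0.
apply: lee_nneseries => i _; first by move=> _; exact: integral_ge0.
have mq : measurable_fun setT (fun w =>
    ((ip1 (AY w) (e i) - ip1 mu0 (e i)) ^+ 2)%:E : \bar R).
  by apply/measurable_EFinP; apply: measurable_funX; exact: measurable_funB.
under eq_integral => w _.
  rewrite (_ : (_ + _)%:E = ((32 * s i)%:E +
    2%:E * ((ip1 (AY w) (e i) - ip1 mu0 (e i)) ^+ 2)%:E)%E); last first.
    by rewrite -EFinM -EFinD.
  over.
rewrite ge0_integralD//=; last 3 first.
- by move=> w _; rewrite lee_fin; apply: mulr_ge0 => //; exact: ltW (s0 i).
- by move=> w _; rewrite -EFinM lee_fin mulr_ge0 ?sqr_ge0.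
- by apply: emeasurable_funM.
rewrite ge0_integralZl//=; last by move=> w _; rewrite lee_fin sqr_ge0.
rewrite integral_cst//= probability_setT mule1.
have := lee_wpmul2l (_ : 0 <= 2%:E)%E (posterior_mean_risk_le i).
rewrite lee_fin => /(_ (ler0n _ _)) h.
apply: (le_trans (leeD2l _ h)).
rewrite -EFinM -EFinD -EFinD lee_fin -/(u i) -/(s i).
rewrite le_eqVlt; apply/orP; left; apply/eqP; ring.
Qed.

End posterior_risk.

(** * Comparing the coordinate risks with the rate *)

Lemma nneseries_le_of_sums (R : realType) (t : nat -> R) (B : R) :
  (forall i, 0 <= t i) -> (forall m, \sum_(i < m) t i <= B) ->
  (\sum_(0 <= i <oo) (t i)%:E <= B%:E)%E.
Proof.
move=> t0 tB; apply: lime_le.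
  by apply: is_cvg_nneseries => i _ _; rewrite lee_fin.
by apply: nearW => m; rewrite sumEFin lee_fin big_mkord.
Qed.

(** The first summand is the constant of the posterior spread and the second
    one that of the bias; [c] is a lower bound for [k i * i.+1%:R `^ (2 * p)] and
    [B] an upper bound for the squared Sobolev norm. *)
Definition risk_constant (R : realType) (alpha beta p c B : R) : R :=
  36 * (2 `^ (1 + 2 * alpha) / (2 * alpha) *
        c `^ (- (2 * alpha / (1 + 2 * alpha + 2 * p)))) +
  4 * (c `^ (- Num.min (beta / (1 + 2 * alpha + 2 * p)) 1) ^+ 2 * B).

Lemma risk_constant_ge0 (R : realType) (alpha beta p c B : R) :
  0 < alpha -> 0 <= B -> 0 <= risk_constant alpha beta p c B.
Proof.
move=> a0 B0; rewrite /risk_constant.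
apply: addr_ge0; apply: mulr_ge0 => //; last by rewrite mulr_ge0 ?sqr_ge0.
by rewrite mulr_ge0 ?divr_ge0 ?powR_ge0// mulr_ge0// ltW.
Qed.

(** The bound depends on the coefficients [m] of the truth only through [B],
    which is what makes the contraction uniform over Sobolev balls. *)
Lemma risk_series_le (R : realType) (alpha beta p c B : R) (tau : nat -> R)
    (n : nat) (k lam m : nat -> R) :
  0 < alpha -> 0 <= p -> 0 < beta -> 0 < c -> (0 < n)%N -> 0 < tau n ->
  (forall i, lam i = tau n ^+ 2 * i.+1%:R `^ (- 1 - 2 * alpha)) ->
  (forall i, c * i.+1%:R `^ (- (2 * p)) <= k i) ->
  (\sum_(0 <= i <oo) (m i ^+ 2 * i.+1%:R `^ (2 * beta))%:E <= B%:E)%E ->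
  (\sum_(0 <= i <oo) (36 * (lam i / (1 + n%:R * lam i * k i)))%:E +
   \sum_(0 <= i <oo) (4 * (m i ^+ 2 * (1 + n%:R * lam i * k i)^-1 ^+ 2))%:E <=
   (risk_constant alpha beta p c B * rate alpha beta p tau n ^+ 2)%:E)%E.
Proof.
move=> a0 p0 b0 c0 n0 t0 lamE kc mB.
set D := 1 + 2 * alpha + 2 * p; set theta := Num.min (beta / D) 1.
have D0 : 0 < D by rewrite /D; lra.
have nR : 0 < n%:R :> R by rewrite ltr0n.
set x := n%:R * tau n ^+ 2.
have x0 : 0 < x by rewrite mulr_gt0 ?exprn_gt0.
have j0 i : 0 < i.+1%:R :> R by rewrite ltr0n.
have lam0 i : 0 < lam i by rewrite lamE mulr_gt0 ?exprn_gt0 ?powR_gt0.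
have th0 : 0 <= theta by rewrite le_min ler01 divr_ge0 ?ltW.
have th1 : theta <= 1 by rewrite ge_min lexx orbT.
have Dth : D * theta <= beta.
  by rewrite mulrC -ler_pdivlMr// ge_min lexx.
have uE i : c * x * i.+1%:R `^ (- D) <= n%:R * lam i * k i.
  have -> : c * x * i.+1%:R `^ (- D) =
      n%:R * lam i * (c * i.+1%:R `^ (- (2 * p))).
    have -> : - D = (- 1 - 2 * alpha) + - (2 * p) by rewrite /D; lra.
    rewrite powRD; last by rewrite (gt_eqF (j0 i)) implybT.
    rewrite /x lamE; ring.
  by rewrite ler_wpM2l// mulr_ge0 ?(ltW nR) ?(ltW (lam0 i)).
have t1 i : 0 < c * x * i.+1%:R `^ (- D) by rewrite !mulr_gt0 ?powR_gt0.
have spread : (\sum_(0 <= i <oo) (36 * (lam i / (1 + n%:R * lam i * k i)))%:E <=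
    (36 * (2 `^ (1 + 2 * alpha) / (2 * alpha) * c `^ (- (2 * alpha / D))) *
     (tau n * x `^ (- (alpha / D))) ^+ 2)%:E)%E.
  apply: nneseries_le_of_sums => [i|N].
    rewrite mulr_ge0// divr_ge0 ?(ltW (lam0 i))// addr_ge0//.
    exact: le_trans (ltW (t1 i)) (uE i).
  have -> : 36 * (2 `^ (1 + 2 * alpha) / (2 * alpha) * c `^ (- (2 * alpha / D))) *
      (tau n * x `^ (- (alpha / D))) ^+ 2 = 36 * (tau n ^+ 2 *
     (2 `^ (1 + 2 * alpha) / (2 * alpha) * (c * x) `^ (- (2 * alpha / D)))).
    rewrite (powRM _ (ltW c0) (ltW x0)) exprMn powR_sqr.
    have -> : 2 * - (alpha / D) = - (2 * alpha / D) by rewrite mulrN mulrA.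
    ring.
  rewrite -mulr_sumr ler_pM2l//.
  apply: (@le_trans _ _ (tau n ^+ 2 * \sum_(i < N)
     i.+1%:R `^ (- 1 - 2 * alpha) / (1 + c * x * i.+1%:R `^ (- D)))).
    rewrite mulr_sumr; apply: ler_sum => i _.
    rewrite mulrA -lamE ler_pM2l//.
    have tu := uE i; have ti := t1 i.
    by rewrite lef_pV2 ?posrE ?lerD2l// ltr_wpDr// ltW// (lt_le_trans ti).
  rewrite ler_pM2l ?exprn_gt0//.
  apply: posterior_spread_sum_le => //; first by rewrite mulr_gt0.
  rewrite /D; lra.
have bias : (\sum_(0 <= i <oo)
      (4 * (m i ^+ 2 * (1 + n%:R * lam i * k i)^-1 ^+ 2))%:E <=
    (4 * (c `^ (- theta) ^+ 2 * B) * x `^ (- theta) ^+ 2)%:E)%E.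
  apply: (@le_trans _ _ (\sum_(0 <= i <oo)
     ((4 * (c * x) `^ (- theta) ^+ 2)%:E * (m i ^+ 2 * i.+1%:R `^ (2 * beta))%:E))%E).
    apply: lee_nneseries => i _.
      by move=> _; rewrite lee_fin mulr_ge0// mulr_ge0 ?sqr_ge0.
    rewrite -EFinM lee_fin -[leRHS]mulrA ler_pM2l//.
    rewrite [leRHS]mulrCA ler_wpM2l ?sqr_ge0//.
    by apply: shrinkage_bias_le (uE i) => //; rewrite ?ler1n ?th0.
  rewrite nneseriesZl//; last by move=> i _; rewrite lee_fin mulr_ge0 ?sqr_ge0 ?powR_ge0.
  apply: (@le_trans _ _ ((4 * (c * x) `^ (- theta) ^+ 2)%:E * B%:E)%E).
    by rewrite lee_wpmul2l// lee_fin mulr_ge0 ?sqr_ge0.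
  rewrite -EFinM lee_fin (powRM _ (ltW c0) (ltW x0)) exprMn.
  rewrite le_eqVlt; apply/orP; left; apply/eqP; ring.
have B0 : 0 <= B.
  rewrite -lee_fin; apply: le_trans mB; apply: nneseries_ge0 => i _ _.
  by rewrite lee_fin mulr_ge0 ?sqr_ge0 ?powR_ge0.
apply: (le_trans (leeD spread bias)); rewrite -EFinD lee_fin /risk_constant [leRHS]mulrDl.
rewrite /rate -/D -/theta -/x.
have X0 : 0 <= x `^ (- theta) by exact: powR_ge0.
have Y0 : 0 <= tau n * x `^ (- (alpha / D)) by rewrite mulr_ge0 ?powR_ge0// ltW.
apply: lerD; apply: ler_wpM2l.
- by rewrite !mulr_ge0 ?powR_ge0 ?invr_ge0 ?mulr_ge0 ?ltW.
- by apply: lerXn2r; rewrite ?nnegrE ?addr_ge0// lerDr.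
- by rewrite mulr_ge0// mulr_ge0 ?sqr_ge0.
- by apply: lerXn2r; rewrite ?nnegrE ?addr_ge0// lerDl.
Qed.

Lemma sobolev_norm_le (R : realType) (H : completeNormedModType R)
    (ip : {dot H for idfun}) (e : nat -> H) (beta r : R) (mu : H) :
  (sobolev_norm ip e beta mu <= r%:E)%E ->
  (\sum_(0 <= i <oo) ((ip mu (e i)) ^+ 2 * i.+1%:R `^ (2 * beta))%:E
     <= (r ^+ 2)%:E)%E.
Proof.
rewrite /sobolev_norm; set S := (\sum_(_ <= _ <oo) _)%E.
have : (0 <= S)%E.
  by apply: nneseries_ge0 => i _ _; rewrite lee_fin mulr_ge0 ?sqr_ge0 ?powR_ge0.
case: S => [s| |]//=.
- rewrite !lee_fin => s0 sr; rewrite -(powRr1 s0).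
  rewrite -[1](@mulVf _ 2)// powRrM powR_mulrn ?powR_ge0//.
  by apply: lerXn2r; rewrite ?nnegrE ?powR_ge0// (le_trans (powR_ge0 _ _) sr).
- by move=> _; rewrite invr_eq0 pnatr_eq0/= leye_eq.
Qed.

(** The truth 0 lies in every Sobolev ball, so the supremum over a ball is
    taken over a nonempty family and is nonnegative. *)
Lemma sobolev_norm0 (R : realType) (H : completeNormedModType R)
    (ip : {dot H for idfun}) (e : nat -> H) (beta : R) :
  sobolev_norm ip e beta 0 = 0%E.
Proof.
rewrite /sobolev_norm eseries0 ?poweR0r ?invr_eq0 ?pnatr_eq0//.
by move=> i _ _; rewrite linear0l expr0n mul0r.
Qed.

Lemma cvg_const_over_sqr (R : realType) (A : R) (M : nat -> R) : 0 <= A ->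
  M @ \oo --> +oo -> (A / M n ^+ 2)%:E @[n --> \oo] --> (0 : \bar R)%E.
Proof.
move=> A0 Moo.
have M1 : \forall n \near \oo, 1 <= M n by move/cvgryPge : Moo; exact.
apply: cvg_EFin; first by apply: nearW.
have Minv : (M n)^-1 @[n --> \oo] --> (0 : R).
  apply/gtr0_cvgV0 => //; near=> n; apply: (@lt_le_trans _ _ 1) => //.
  by near: n.
apply: (@squeeze_cvgr _ _ _ _ (fun=> 0) (fun n => A * (M n)^-1)).
- near=> n; have Mn : 1 <= M n by near: n.
  have M0 : 0 < M n by apply: lt_le_trans Mn.
  rewrite /= divr_ge0 ?sqr_ge0//= ler_wpM2l// lef_pV2 ?posrE ?exprn_gt0//.
  by rewrite expr2 ler_peMr// ltW.
- exact: cvg_cst.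
- by rewrite -[X in _ --> X](mulr0 A); apply: cvgM => //; exact: cvg_cst.
Unshelve. all: by end_near. Qed.

(** * Contraction of the posterior *)

Lemma rate_gt0 (R : realType) (alpha beta p : R) (tau : nat -> R) (n : nat) :
  (0 < n)%N -> 0 < tau n -> 0 < rate alpha beta p tau n.
Proof.
move=> n0 t0; rewrite /rate ltr_wpDr ?mulr_ge0 ?powR_ge0 ?(ltW t0)//.
by rewrite powR_gt0// mulr_gt0 ?exprn_gt0 ?ltr0n.
Qed.

Theorem theorem4p1 (R : realType)
  (* Hilbert spaces *)
  (H1 H2 : completeNormedModType R)
  (ip1 : {dot H1 for idfun}) (ip2 : {dot H2 for idfun})
  (hip1 : induces_norm ip1) (hip2 : induces_norm ip2)
  (hsep1 : separable H1) (hsep2 : separable H2)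
  (* forward operator *)
  (K : {linear H1 -> H2}) (hKcont : continuous K) (hKinj : injective K)
  (* common eigenbasis of K^T K and Lambda *)
  (e : nat -> H1) (he : orthonormal_basis ip1 e)
  (alpha p beta C : R)
  (halpha : 0 < alpha) (hp : 0 <= p) (hbeta : 0 < beta) (hC : 1 <= C)
  (kappa : nat -> R) (hkappa0 : forall i, 0 < kappa i)
  (hkappa : forall i, C^-1 * i.+1%:R `^ (- p) <= kappa i <= C * i.+1%:R `^ (- p))
  (hKe : forall i, adjoint ip1 ip2 K (K (e i)) = kappa i ^+ 2 *: e i)
  (tau : nat -> R) (htau0 : forall n, (0 < n)%N -> 0 < tau n)
  (htau : n%:R * tau n ^+ 2 @[n --> \oo] --> +oo)
  (Lam : nat -> {linear H1 -> H1})
  (hLamcont : forall n, (0 < n)%N -> continuous (Lam n))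
  (hLame : forall n i, (0 < n)%N ->
     Lam n (e i) = (tau n ^+ 2 * i.+1%:R `^ (- 1 - 2 * alpha)) *: e i)
  (* observation: [P n mu] governs Y^n = K mu + n^{-1/2} Z *)
  (d : nat -> measure_display) (Omega : forall n, measurableType (d n))
  (Y : forall n, H2 -> {mfun Omega n >-> R})
  (P : forall n, H1 -> probability (Omega n) R)
  (hY : forall n mu, (0 < n)%N ->
     white_noise_model ip2 (P n mu) (Y n) (K mu) n)
  (* prior N(0, Lambda) and posterior N(AY, S_n) *)
  (prior : nat -> probability (borel H1) R)
  (hprior : forall n, (0 < n)%N -> gaussian_measure ip1 (prior n) 0 (Lam n))
  (AY : forall n, Omega n -> H1)
  (hAYmeas : forall n, (0 < n)%N ->
     measurable_fun [set: Omega n] (AY n : Omega n -> borel H1))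
  (hAY : forall n mu, (0 < n)%N ->
     represents_image ip1 ip2 (P n mu) (Y n)
       (posterior_gain ip1 ip2 K (Lam n) n) (AY n))
  (post : forall n, R.-pker (Omega n) ~> borel H1)
  (hpost : forall n, (0 < n)%N ->
     posterior_distribution (prior n) (P n) (Y n) (post n))
  (hpostN : forall n w, (0 < n)%N ->
     gaussian_measure ip1 (post n w) (AY n w)
       (posterior_covariance ip1 ip2 K (Lam n) n)) :
  (forall M : nat -> R, M @ \oo --> +oo ->
     (forall mu0 : H1, sobolev_space ip1 e beta mu0 ->
        expected_posterior_mass (P n mu0) (post n) mu0
          (M n * rate alpha beta p tau n) @[n --> \oo] --> 0%E) /\
     (forall r : R, 0 < r ->
        ereal_sup [set expected_posterior_mass (P n mu0) (post n) mu0
                         (M n * rate alpha beta p tau n)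
                  | mu0 in [set mu0 | sobolev_space ip1 e beta mu0 /\
                                      (sobolev_norm ip1 e beta mu0 <= r%:E)%E]]
          @[n --> \oo] --> 0%E)) /\
  ((forall n, (0 < n)%N -> tau n = 1) ->
     same_order (rate alpha beta p tau)
       (fun n => n%:R `^ (- (Num.min alpha beta / (1 + 2 * alpha + 2 * p))))) /\
  (beta <= 1 + 2 * alpha + 2 * p ->
     same_order tau
       (fun n => n%:R `^ ((alpha - beta) / (1 + 2 * beta + 2 * p))) ->
     same_order (rate alpha beta p tau)
       (fun n => n%:R `^ (- (beta / (1 + 2 * beta + 2 * p))))) /\
  (1 + 2 * alpha + 2 * p < beta ->
     forall tau' : nat -> R, (forall n, (0 < n)%N -> 0 < tau' n) ->
     much_larger (rate alpha beta p tau')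
       (fun n => n%:R `^ (- (beta / (1 + 2 * beta + 2 * p))))).
Proof.
pose D := 1 + 2 * alpha + 2 * p.
(* kappa i ^+ 2 >= c * j `^ (- 2 p), from the lower bound on kappa. *)
pose c := C^-1 ^+ 2.
have C0 : 0 < C by exact: lt_le_trans hC.
have c0 : 0 < c by rewrite exprn_gt0 ?invr_gt0.
pose E n mu0 (r : R) := expected_posterior_mass (P n mu0) (post n) mu0 r.
have mass_le n mu0 B r : (0 < n)%N -> 0 < r ->
    (\sum_(0 <= i <oo) ((ip1 mu0 (e i)) ^+ 2 * i.+1%:R `^ (2 * beta))%:E
       <= B%:E)%E ->
    (E n mu0 (r * rate alpha beta p tau n)%R <=
     (risk_constant alpha beta p c B / r ^+ 2)%:E)%E.
  move=> n0 r0 muB.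
  have tau0 := htau0 n n0.
  have eps0 := rate_gt0 alpha beta p n0 tau0.
  have re0 : 0 < (r * rate alpha beta p tau n) ^+ 2 by rewrite exprn_gt0 ?mulr_gt0.
  pose lam i := tau n ^+ 2 * i.+1%:R `^ (- 1 - 2 * alpha).
  have lam0 i : 0 < lam i by rewrite /lam mulr_gt0 ?exprn_gt0 ?powR_gt0.
  have := expected_posterior_mass_le hip1 hip2 he hKcont (hLamcont n n0) hKe
    (fun i => hLame n i n0) lam0 n0 (hY n mu0 n0) (hAYmeas n n0) (hAY n mu0 n0)
    (fun w => hpostN n w n0) (ltW (mulr_gt0 r0 eps0)).
  have kc i : c * i.+1%:R `^ (- (2 * p)) <= kappa i ^+ 2.
    have -> : - (2 * p) = 2 * - p by rewrite mulrN.
    rewrite -powR_sqr -exprMn; have /andP[lo _] := hkappa i.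
    apply: lerXn2r => //; rewrite nnegrE ?(ltW (hkappa0 i))//.
    by rewrite mulr_ge0 ?powR_ge0 ?invr_ge0 ?(ltW C0).
  move=> h; have := le_trans h (risk_series_le halpha hp hbeta c0 n0 tau0
    (fun i => erefl (lam i)) kc muB).
  rewrite -lee_pdivlMl// -EFinM => /le_trans; apply; rewrite lee_fin.
  rewrite le_eqVlt; apply/orP; left; apply/eqP.
  by field; rewrite ?gt_eqF.
have mass_ge0 n mu0 r : (0 <= E n mu0 r)%E by exact: integral_ge0.
split; last first.
  split; first exact: rate_unscaled.
  split; first exact: rate_optimal_scaling.
  by move=> Db tau' tau'0; exact: rate_suboptimal.
move=> M Moo.
have Mgt0 : \forall n \near \oo, (0 < n)%N /\ 0 < M n.
  near=> n; split; first by near: n; exact: nbhs_infty_gt.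
  by near: n; move/cvgryPgt : Moo; exact.
have vanish B : 0 <= B ->
    (risk_constant alpha beta p c B / M n ^+ 2)%:E @[n --> \oo] --> (0 : \bar R)%E.
  by move=> B0; apply: cvg_const_over_sqr => //; exact: risk_constant_ge0.
split.
  move=> mu0 mu0S.
  pose r := fine (sobolev_norm ip1 e beta mu0).
  have rE : (sobolev_norm ip1 e beta mu0 <= r%:E)%E.
    by rewrite /r fineK// ge0_fin_numE// poweR_ge0.
  have vr := vanish (r ^+ 2) (sqr_ge0 _).
  apply: (squeeze_cvge _ (cvg_cst 0%E) vr); near=> n.
  have [n0 Mn] : (0 < n)%N /\ 0 < M n by near: n.
  by rewrite mass_ge0/=; apply: mass_le => //; exact: sobolev_norm_le.
move=> r r0.
have vr := vanish (r ^+ 2) (sqr_ge0 _).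
apply: (squeeze_cvge _ (cvg_cst 0%E) vr); near=> n.
have [n0 Mn] : (0 < n)%N /\ 0 < M n by near: n.
apply/andP; split.
  apply: (le_trans (mass_ge0 n 0 (M n * rate alpha beta p tau n))).
  apply: ereal_sup_ubound; exists 0 => //.
  by rewrite /sobolev_space /= sobolev_norm0 ltry lee_fin (ltW r0).
apply: ge_ereal_sup => _ [mu0 [_ mu0r] <-].
by apply: mass_le => //; exact: sobolev_norm_le.
Unshelve. all: by end_near. Qed.
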